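(* Let $p\neq2$ be a prime, $\alpha>0$ and $m\in\mathbb{Q}_p^\times$. Let $(E,\boldsymbol{p})\in V_{m^2}^{+}$ or $(E,\boldsymbol{p})\in V_{m^2}^{-}$, i.e. $E=\pm\sqrt{\boldsymbol{p}\cdot\boldsymbol{p}+m^2}$. Then $u(t,\boldsymbol{x})=\chi_p\big([(t,\boldsymbol{x}),(E,\boldsymbol{p})]\big)$ is a weak solution of $(\square_{\alpha,m}u)(t,\boldsymbol{x})=0$.
   Context: $\mathbf{S}(\mathbb{Q}_p^4)$ is the space of locally constant compactly supported complex functions, $\mathbf{S}'(\mathbb{Q}_p^4)$ the space of all linear functionals on it. For $x=(x_0,\boldsymbol{x}),y=(y_0,\boldsymbol{y})\in\mathbb{Q}_p\times\mathbb{Q}_p^3$: $[x,y]=x_0y_0-\boldsymbol{x}\cdot\boldsymbol{y}$, $\boldsymbol{x}\cdot\boldsymbol{y}=x_1y_1+x_2y_2+x_3y_3$, $Q(x)=[x,x]$. $\chi_p(y)=\exp(2\pi i\{y\}_p)$ ($\{y\}_p$ the fractional part), $\mathcal{F}[\varphi](k)=\int_{\mathbb{Q}_p^4}\chi_p([x,k])\varphi(x)\,d^4x$ ($d^4x$ normalized Haar measure), extended to distributions by $(\mathcal{F}T,\varphi)=(T,\mathcal{F}\varphi)$. Positivity: $a=p^{ord(a)}ac(a)\in\mathbb{Q}_p^\times$, $|ac(a)|_p=1$, is positive ($a>0$) if the reduction of $ac(a)$ mod $p$ lies in $\{1,\dots,\frac{p-1}{2}\}$, and negative ($a<0$) otherwise.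 $V_{m^2}^{\pm}=\{(k_0,\boldsymbol{k})\in\mathbb{Q}_p^4:Q(k)=m^2,\ \pm k_0>0\}$; $\sqrt{\cdot}$ denotes the positive square root. Product of distributions: with $\delta_j(x)=p^{4j}\Omega(p^j\|x\|_p)$, $\Omega$ the characteristic function of $[0,1]$, $\|x\|_p=\max_i|x_i|_p$, $(TS,\varphi)=\lim_{j\to+\infty}(S,(T*\delta_j)\varphi)$ if the limit exists for all $\varphi\in\mathbf{S}(\mathbb{Q}_p^4)$. $\square_{\alpha,m}T=\mathcal{F}^{-1}[|[k,k]-m^2|_p^\alpha\mathcal{F}T]$ is defined on the space $\mathcal{E}_{Q,m}$ of $T\in\mathbf{S}'(\mathbb{Q}_p^4)$ for which the product $|[k,k]-m^2|_p^\alpha\mathcal{F}T$ exists. A weak solution of $\square_{\alpha,m}T=S$ is a $T\in\mathcal{E}_{Q,m}$ satisfying this equality. A locally constant function is identified with the distribution it defines by integration. *)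

(* Defs.v *)
From HB Require Import structures.
From mathcomp Require Import all_boot all_order all_algebra.
From mathcomp Require Import complex.
From mathcomp Require Import zify.
From mathcomp Require Import all_classical all_reals all_analysis.

Set Implicit Arguments.
Unset Strict Implicit.
Unset Printing Implicit Defensive.

Import Order.TTheory GRing.Theory Num.Theory.
Import numFieldNormedType.Exports.
Local Open Scope classical_set_scope.
Local Open Scope ring_scope.

(* Z_p is the inverse limit of the Z/p^n, and Q_p its field of fractions. *)

Section PadicInt.
Variables (p : nat) (p_pr : prime p).

Local Notation pn n := ((p%:Z ^+ n)%R : int).

Lemma pn_gt0 n : (0 : int) < pn n.
Proof. by rewrite exprn_gt0// ltz_nat prime_gt0. Qed.

Lemma pn_neq0 n : pn n != 0.
Proof. by rewrite gt_eqF// pn_gt0. Qed.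

Lemma dvd_pn m n : (m <= n)%N -> (pn m %| pn n)%Z.
Proof. by move=> mn; rewrite -(subnKC mn) exprD dvdz_mulr. Qed.

Lemma modz_pn a m n : (m <= n)%N -> ((a %% pn n)%Z = a %[mod pn m])%Z.
Proof.
move=> mn; apply/eqP; rewrite eqz_mod_dvd.
rewrite {2}(divz_eq a (pn n)) opprD addrCA subrr addr0.
by rewrite rpredN dvdz_mull// dvd_pn.
Qed.

(* [x n] is the representative in [0, p^n) of the class of [x] modulo p^n. *)
Definition coherent (x : nat -> int) := forall n, x n = (x n.+1 %% pn n)%Z.

(* The primality proof is a parameter of the type so that the canonical
   structures below, which depend on it, can be inferred. *)
Record padic_int (q : prime p) :=
  PadicInt { residue :> nat -> int; _ : `[< coherent residue >] }.

Local Notation Zp := (padic_int p_pr).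

HB.instance Definition _ := [isSub for @residue p_pr].
HB.instance Definition _ := [Choice of Zp by <:].

Implicit Types x y z : Zp.

Lemma residueP x n : x n = (x n.+1 %% pn n)%Z.
Proof. by case: x => f /= /asboolP; apply. Qed.

Lemma residue_small x n : (x n %% pn n)%Z = x n.
Proof. by rewrite [x n in RHS]residueP [x n in LHS]residueP modz_mod. Qed.

Lemma residue_mod x m n : (m <= n)%N -> (x n %% pn m)%Z = x m.
Proof.
move=> mn; rewrite -(subnKC mn); elim: (n - m)%N => [|k IH].
  by rewrite addn0 residue_small.
rewrite addnS -{}IH [in RHS]residueP.
by rewrite modz_pn // leq_addr.
Qed.

Lemma padic_int_eqP x y : (forall n, (x n = y n %[mod pn n])%Z) -> x = y.
Proof.
move=> xy; apply/val_inj/funext => n /=.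
by rewrite -residue_small xy residue_small.
Qed.

Lemma of_seq_subproof (f : nat -> int) :
  (forall n, (f n.+1 = f n %[mod pn n])%Z) ->
  `[< coherent (fun n => (f n %% pn n)%Z) >].
Proof.
move=> cf; apply/asboolP => n.
by rewrite modz_pn// cf.
Qed.

Definition of_seq f cf : Zp := PadicInt p_pr (@of_seq_subproof f cf).

Lemma of_seqE f cf n : (@of_seq f cf n = f n %[mod pn n])%Z.
Proof. by rewrite /= modz_mod. Qed.

Lemma residueS x n : (x n.+1 = x n %[mod pn n])%Z.
Proof. by rewrite -residueP residue_small. Qed.

Fact add_subproof x y n :
  (x n.+1 + y n.+1 = x n + y n %[mod pn n])%Z.
Proof. by rewrite -modzDm !residueS modzDm. Qed.

Fact mul_subproof x y n :
  (x n.+1 * y n.+1 = x n * y n %[mod pn n])%Z.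
Proof. by rewrite -modzMm !residueS modzMm. Qed.

Fact opp_subproof x n : (- x n.+1 = - x n %[mod pn n])%Z.
Proof. by rewrite -modzNm residueS modzNm. Qed.

Fact int_subproof (a : int) n : (a = a %[mod pn n])%Z.
Proof. by []. Qed.

Definition padd x y := of_seq (add_subproof x y).
Definition pmul x y := of_seq (mul_subproof x y).
Definition popp x := of_seq (opp_subproof x).
Definition pint a := of_seq (int_subproof a).

Let paddA : associative padd.
Proof.
move=> x y z; apply: padic_int_eqP => n.
by rewrite !of_seqE -modzDmr of_seqE modzDmr -[RHS]modzDml of_seqE modzDml addrA.
Qed.

Let paddC : commutative padd.
Proof. by move=> x y; apply: padic_int_eqP => n; rewrite !of_seqE addrC. Qed.

Let padd0 : left_id (pint 0) padd.
Proof.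
by move=> x; apply: padic_int_eqP => n; rewrite of_seqE -modzDml of_seqE modzDml add0r.
Qed.

Let paddN : left_inverse (pint 0) popp padd.
Proof.
by move=> x; apply: padic_int_eqP => n; rewrite !of_seqE -modzDml of_seqE modzDml addNr.
Qed.

HB.instance Definition _ := GRing.isZmodule.Build Zp paddA paddC padd0 paddN.

Let pmulA : associative pmul.
Proof.
move=> x y z; apply: padic_int_eqP => n.
by rewrite !of_seqE -modzMmr of_seqE modzMmr -[RHS]modzMml of_seqE modzMml mulrA.
Qed.

Let pmulC : commutative pmul.
Proof. by move=> x y; apply: padic_int_eqP => n; rewrite !of_seqE mulrC. Qed.

Let pmul1 : left_id (pint 1) pmul.
Proof.
by move=> x; apply: padic_int_eqP => n; rewrite of_seqE -modzMml of_seqE modzMml mul1r.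
Qed.

Let pmulDl : left_distributive pmul padd.
Proof.
move=> x y z; apply: padic_int_eqP => n.
rewrite !of_seqE -modzMml of_seqE modzMml -[RHS]modzDm !of_seqE modzDm.
by rewrite mulrDl.
Qed.

Let pone_neq0 : pint 1 != pint 0.
Proof.
apply/eqP => /(congr1 (fun x : Zp => x 1%N)) /= /eqP.
by rewrite mod0z expr1 modz_small// ltz_nat prime_gt1.
Qed.

HB.instance Definition _ := GRing.Zmodule_isComNzRing.Build Zp
  pmulA pmulC pmul1 pmulDl pone_neq0.

Lemma padic_int0E n : (0 : Zp) n = 0.
Proof. by rewrite /= mod0z. Qed.

Lemma padic_intDE x y n : (x + y) n = ((x n + y n) %% pn n)%Z.
Proof. by []. Qed.

Lemma padic_intME x y n : (x * y) n = ((x n * y n) %% pn n)%Z.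
Proof. by []. Qed.

Lemma padic_intNE x n : (- x) n = ((- x n) %% pn n)%Z.
Proof. by []. Qed.

Lemma padic_int_neq0 x : x != 0 -> exists n, x n.+1 != 0.
Proof.
move=> x0; apply: contrapT => /forallNP h; move/eqP: x0; apply.
apply: padic_int_eqP => -[|n]; first by rewrite !modz1.
by rewrite padic_int0E; have /negP := h n; rewrite negbK => /eqP ->.
Qed.

(* The valuation of [x != 0]: the largest n such that [x = 0] modulo p^n. *)
Definition pval x : nat :=
  if pselect (exists n, x n.+1 != 0) is left h then ex_minn h else 0%N.

Lemma residue_eq0 x n N : x != 0 -> (n <= N)%N ->
  (pn n %| x N)%Z = (n <= pval x)%N.
Proof.
move=> x0 nN; rewrite /pval; case: pselect => [h|/(_ (padic_int_neq0 x0))//].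
case: ex_minnP => v xv vmin.
have -> : (pn n %| x N)%Z = (x n == 0).
  by rewrite -(residue_mod x nN); apply/dvdz_mod0P/eqP.
apply/eqP/idP => [xn0|nv]; last first.
  case: n nv {nN} => [|n] nv; first by rewrite -residue_small modz1.
  by apply/eqP; apply: contraTT nv => /vmin; rewrite -ltnNge ltnS.
rewrite leqNgt; apply/negP => vn; move/negP: xv; apply.
by rewrite -(residue_mod x vn) xn0 mod0z.
Qed.

Lemma residue_neq0 x N : x != 0 -> (pval x < N)%N -> x N != 0.
Proof.
move=> x0 vN; apply/eqP => xN0.
by have := residue_eq0 x0 (leqnn N); rewrite xN0 dvdz0 leqNgt vN.
Qed.

Lemma logn_residue x N : x != 0 -> (pval x < N)%N ->
  logn p `|x N|%N = pval x.
Proof.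
move=> x0 vN; have xN0 := residue_neq0 x0 vN.
have E n : (n <= N)%N -> (n <= logn p `|x N|)%N = (n <= pval x)%N.
  move=> nN; rewrite -(residue_eq0 x0 nN) dvdzE abszX absz_nat.
  by rewrite pfactor_dvdn// absz_gt0.
apply/eqP; rewrite eqn_leq (E _ (ltnW vN)) leqnn andbT leqNgt.
by rewrite E// ltnn.
Qed.

Lemma pvalP x y N : x != 0 -> y != 0 -> (pval x + pval y < N)%N ->
  (pval x < N)%N * (pval y < N)%N.
Proof.
by move=> _ _ h; split; apply: leq_ltn_trans h; rewrite ?leq_addr ?leq_addl.
Qed.

Lemma logn_mul_residue x y N : x != 0 -> y != 0 -> (pval x + pval y < N)%N ->
  logn p `|(x N * y N)%R|%N = (pval x + pval y)%N.
Proof.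
move=> x0 y0 N_gt; have [vx vy] := pvalP x0 y0 N_gt.
by rewrite abszM lognM ?absz_gt0 ?residue_neq0// !logn_residue.
Qed.

Lemma dvd_mul_residue x y N n : x != 0 -> y != 0 -> (pval x + pval y < N)%N ->
  (pn n %| x N * y N)%Z = (n <= pval x + pval y)%N.
Proof.
move=> x0 y0 N_gt; have [vx vy] := pvalP x0 y0 N_gt.
rewrite dvdzE abszX absz_nat pfactor_dvdn ?logn_mul_residue//.
by rewrite abszM muln_gt0 !absz_gt0 !residue_neq0.
Qed.

Let pmul_eq0 x y : x * y = 0 -> (x == 0) || (y == 0).
Proof.
move=> xy0; apply/negPn/negP; rewrite negb_or => /andP[x0 y0].
set N := (pval x + pval y).+1.
have := @dvd_mul_residue x y N N x0 y0 (leqnn _); rewrite leqNgt leqnn/=.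
move/negP; apply; apply/dvdz_mod0P.
by rewrite -padic_intME xy0 padic_int0E.
Qed.

Let is_unit : pred Zp := fun x => `[< exists y, y * x = 1 >].
Let pinv x := if pselect (exists y, y * x = 1) is left h
  then projT1 (cid h) else x.

Let pmulV : {in is_unit, left_inverse 1 pinv *%R}.
Proof.
move=> x /asboolP xU; rewrite /pinv; case: pselect => // h.
by case: (cid h).
Qed.

Let is_unitP x y : y * x = 1 -> is_unit x.
Proof. by move=> yx; apply/asboolP; exists y. Qed.

Let pinv_out : {in [predC is_unit], pinv =1 id}.
Proof.
by move=> x /asboolPn xU; rewrite /pinv; case: pselect.
Qed.

HB.instance Definition _ := GRing.ComNzRing_hasMulInverse.Build Zp
  pmulV is_unitP pinv_out.
HB.instance Definition _ := GRing.ComUnitRing_isIntegral.Build Zp pmul_eq0.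

Lemma pvalM x y : x != 0 -> y != 0 -> pval (x * y) = (pval x + pval y)%N.
Proof.
move=> x0 y0; have xy0 : x * y != 0 by rewrite mulf_neq0.
have E n : (n <= pval (x * y)%R)%N = (n <= pval x + pval y)%N.
  set N := (maxn n (pval x + pval y).+1).
  rewrite -(residue_eq0 (N := N) xy0) ?leq_maxl// padic_intME.
  rewrite -(dvd_mul_residue (N := N) n x0 y0) ?leq_maxr//.
  apply/dvdz_mod0P/dvdz_mod0P; rewrite modz_pn// leq_maxl//.
by apply/eqP; rewrite eqn_leq E leqnn -E leqnn.
Qed.

Lemma pvalD x y : x != 0 -> y != 0 -> x + y != 0 ->
  (minn (pval x) (pval y) <= pval (x + y)%R)%N.
Proof.
move=> x0 y0 xy0; set n := minn _ _.
rewrite -(residue_eq0 xy0 (leqnn n)) padic_intDE.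
apply/dvdz_mod0P; rewrite modz_mod; apply/dvdz_mod0P.
by rewrite rpredD// residue_eq0// ?geq_minl ?geq_minr.
Qed.

Lemma pvalN x : pval (- x) = pval x.
Proof.
have E n : ((- x) n.+1 != 0) = (x n.+1 != 0).
  rewrite padic_intNE -[x n.+1 in RHS]residue_small; congr negb.
  by apply/eqP/eqP => /dvdz_mod0P; rewrite ?rpredN => h; apply/dvdz_mod0P; rewrite ?rpredN.
rewrite /pval; case: pselect => [h|h]; case: pselect => // h'.
- by apply: eq_ex_minn => n; rewrite E.
- by case: h'; case: h => n; rewrite E => xn; exists n.
- by case: h; case: h' => n xn; exists n; rewrite E.
Qed.

End PadicInt.

Section Padic.
Variables (p : nat) (p_pr : prime p).

Definition padic := {fraction (padic_int p_pr)}.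

HB.instance Definition _ := GRing.Field.on padic.

Local Notation Zp := (padic_int p_pr).
Local Notation Qp := padic.
Local Notation "x %:F" := (@FracField.tofrac (padic_int p_pr) x).
Implicit Types x y z : Qp.

Lemma padic_repr x : x = ((repr x).1)%:F / ((repr x).2)%:F.
Proof.
have d0 : ((repr x).2)%:F != 0 :> {fraction Zp}.
  by rewrite tofrac_eq0 denom_ratioP.
apply: (canRL (mulfK d0)).
rewrite -{1}[x]reprK; set r := repr x.
unlock FracField.tofrac; rewrite -[LHS]FracField.pi_mul; apply/eqmodP => /=.
rewrite FracField.equivfE /FracField.mulf !numden_Ratio ?mulr1 ?oner_neq0 ?denom_ratioP//.
by rewrite mulrC.
Qed.

(* On a fraction of p-adic integers ord is the difference of the valuations,
   see [ordE]; [ord 0] is irrelevant. *)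
Definition ord x : int := (pval (repr x).1)%:Z - (pval (repr x).2)%:Z.

Lemma ordE (a b : Zp) : a != 0 -> b != 0 ->
  ord (a%:F / b%:F) = (pval a)%:Z - (pval b)%:Z.
Proof.
move=> a0 b0; rewrite /ord; set x : Qp := a%:F / b%:F.
have := padic_repr x; have := denom_ratioP (repr x).
set n := (repr x).1; set d := (repr x).2 => d0 xE.
have n0 : n != 0.
  apply/eqP => n0; move/eqP: xE; rewrite n0 tofrac0 mul0r.
  by rewrite mulf_eq0 invr_eq0 !tofrac_eq0 (negbTE a0) (negbTE b0).
move/eqP: xE; rewrite eqr_div ?tofrac_eq0// -!tofracM tofrac_eq => /eqP E.
have := congr1 (@pval _ _) E; rewrite !pvalM// => h.
by apply/eqP; rewrite subr_eq addrAC eq_sym subr_eq -!PoszD h.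
Qed.

Definition pnorm x : rat := if x == 0 then 0 else p%:R ^ (- ord x).

Lemma padic_fracP x : x != 0 ->
  exists ab : Zp * Zp, [/\ ab.1 != 0, ab.2 != 0 & x = ab.1%:F / ab.2%:F].
Proof.
move=> x0; exists ((repr x).1, (repr x).2); split => /=.
- apply: contraNneq x0 => n0.
  by rewrite [x]padic_repr n0 tofrac0 mul0r.
- exact: denom_ratioP.
- exact: padic_repr.
Qed.

Lemma ordM x y : x != 0 -> y != 0 -> ord (x * y) = ord x + ord y.
Proof.
move=> /padic_fracP[[a b] /= [a0 b0 ->]] /padic_fracP[[c d] /= [c0 d0 ->]].
rewrite mulf_div -!tofracM !ordE ?mulf_neq0// !pvalM// !PoszD.
by rewrite opprD addrACA.
Qed.

Lemma ordN x : ord (- x) = ord x.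
Proof.
have [->|x0] := eqVneq x 0; first by rewrite oppr0.
have [[a b] /= [a0 b0 ->]] := padic_fracP x0.
by rewrite -mulNr -tofracN !ordE ?oppr_eq0// pvalN.
Qed.

Lemma ordD x y : x != 0 -> y != 0 -> x + y != 0 ->
  Num.min (ord x) (ord y) <= ord (x + y).
Proof.
move=> /padic_fracP[[a b] /= [a0 b0 ->]] /padic_fracP[[c d] /= [c0 d0 ->]].
rewrite addf_div ?tofrac_eq0// -!tofracM -tofracD.
rewrite mulf_eq0 invr_eq0 !tofrac_eq0 mulf_eq0 (negbTE b0) (negbTE d0) !orbF => n0.
have := pvalD (mulf_neq0 a0 d0) (mulf_neq0 c0 b0) n0.
rewrite (ordE a0 b0) (ordE c0 d0) (ordE n0 (mulf_neq0 b0 d0)) !pvalM//.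
move: (pval (_ + _)) (pval a) (pval b) (pval c) (pval d) => k na nb nc nd.
by rewrite ge_min geq_min => /orP[h|h]; apply/orP; [left|right]; lia.
Qed.

Lemma pnorm0 : pnorm 0 = 0. Proof. by rewrite /pnorm eqxx. Qed.

Lemma pR_gt0 : (0 : rat) < p%:R. Proof. by rewrite ltr0n prime_gt0. Qed.

Lemma pnorm_gt0 x : x != 0 -> 0 < pnorm x.
Proof. by move=> /negbTE x0; rewrite /pnorm x0 exprz_gt0// pR_gt0. Qed.

Lemma pnorm_ge0 x : 0 <= pnorm x.
Proof.
by have [->|/pnorm_gt0/ltW//] := eqVneq x 0; rewrite pnorm0.
Qed.

Lemma pnorm_eq0 x : (pnorm x == 0) = (x == 0).
Proof.
by have [->|/[dup] x0 /pnorm_gt0/gt_eqF->] := eqVneq x 0; rewrite ?pnorm0 ?eqxx.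
Qed.

Lemma pnormN x : pnorm (- x) = pnorm x.
Proof. by rewrite /pnorm oppr_eq0 ordN. Qed.

Lemma pnormM x y : pnorm (x * y) = pnorm x * pnorm y.
Proof.
have [->|x0] := eqVneq x 0; first by rewrite mul0r pnorm0 mul0r.
have [->|y0] := eqVneq y 0; first by rewrite mulr0 pnorm0 mulr0.
rewrite /pnorm mulf_eq0 (negbTE x0) (negbTE y0)/= ordM// opprD.
by rewrite expfzDr// gt_eqF// pR_gt0.
Qed.

Lemma pnormD x y : pnorm (x + y) <= Num.max (pnorm x) (pnorm y).
Proof.
have [->|x0] := eqVneq x 0; first by rewrite add0r le_max lexx orbT.
have [->|y0] := eqVneq y 0; first by rewrite addr0 le_max lexx.
have [->|xy0] := eqVneq (x + y) 0; first by rewrite pnorm0 le_max pnorm_ge0.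
rewrite /pnorm (negbTE x0) (negbTE y0) (negbTE xy0).
have := ordD x0 y0 xy0.
have p1 : 1 <= p%:R :> rat by rewrite ler1n prime_gt0.
rewrite ge_min le_max => /orP[h|h]; apply/orP; [left|right];
  by rewrite ler_weXz2l// lerN2.
Qed.

Let mdistxx x : pnorm (x - x) = 0. Proof. by rewrite subrr pnorm0. Qed.

Let mdist_positivity x y : pnorm (x - y) = 0 -> x = y.
Proof. by move/eqP; rewrite pnorm_eq0 subr_eq0 => /eqP. Qed.

Let mdist_sym x y : pnorm (x - y) = pnorm (y - x).
Proof. by rewrite -opprB pnormN. Qed.

Let mdist_triangle y x z : pnorm (x - z) <= pnorm (x - y) + pnorm (y - z).
Proof.
rewrite -(subrKA y) (le_trans (pnormD _ _))// ge_max.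
by rewrite lerDl lerDr !pnorm_ge0.
Qed.

HB.instance Definition _ := isPointed.Build Qp 0.
HB.instance Definition _ := isMetric.Build rat Qp
  mdistxx mdist_positivity mdist_sym mdist_triangle.

End Padic.

Section Characters.
Variables (R : realType) (p : nat) (p_pr : prime p).
Local Notation Qp := (padic p_pr).

(* The complex numbers, as a structure with the topology of the modulus. *)
Definition Cplx : numClosedFieldType := R[i].

(* The fractional part {y}_p is the element of Z[1/p] in [0, 1) which differs
   from y by a p-adic integer. *)
Definition is_fracpart (y : Qp) (q : rat) : Prop :=
  [/\ 0 <= q < 1, exists a n : nat, q = a%:R / p%:R ^+ n
    & pnorm (y - ratr q) <= 1].

Definition fracpart (y : Qp) : rat := xget 0 [set q | is_fracpart y q].

Definition chi (y : Qp) : Cplx :=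
  let t : R := 2 * pi * ratr (fracpart y) in (cos t +i* sin t)%C.

(* The angular component: a = p ^ ord a * ac a with |ac a|_p = 1. *)
Definition ac (a : Qp) : Qp := a / p%:R ^ ord a.

(* The reduction modulo p of [ac a] is the class of some j in 1, ..., (p-1)/2;
   two p-adic integers have the same reduction iff their distance is < 1. *)
Definition padic_pos (a : Qp) : Prop :=
  a != 0 /\ exists j : nat,
    (1 <= j <= p.-1./2)%N /\ pnorm (ac a - j%:R) < 1.

End Characters.

Section Spacetime.
Variables (R : realType) (p : nat) (p_pr : prime p).
Local Notation Qp := (padic p_pr).
Local Notation Cplx := (Cplx R).

Definition Qp4 : Type := (Qp * 'rV[Qp]_3)%type.

HB.instance Definition _ := GRing.Zmodule.on Qp4.
HB.instance Definition _ := Pointed.on Qp4.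
HB.instance Definition _ := PseudoMetric.on Qp4.

Implicit Types (x y k : Qp4) (m : Qp).

Definition dot (v w : 'rV[Qp]_3) : Qp := \sum_(i < 3) v 0 i * w 0 i.

Definition bracket x y : Qp := x.1 * y.1 - dot x.2 y.2.

Definition quadform x : Qp := bracket x x.

Definition vnorm x : rat :=
  Num.max (pnorm x.1) (\big[Num.max/0]_(i < 3) pnorm (x.2 0 i)).

(* [mass_shell false m] is V^+_{m^2}, [mass_shell true m] is V^-_{m^2}. *)
Definition mass_shell (s : bool) m : set Qp4 :=
  [set k | quadform k = m ^+ 2 /\ padic_pos ((-1) ^+ s * k.1)].

Definition test_function (phi : Qp4 -> Cplx) : Prop :=
  (forall x, \forall y \near x, phi y = phi x)
  /\ compact (closure [set x | phi x != 0]).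

Definition borel : Type := g_sigma_algebraType (@open Qp4).

HB.instance Definition _ := Measurable.on borel.

(* By Haar's theorem there is exactly one such measure. *)
Definition normalized_haar (mu : {measure set borel -> \bar R}) : Prop :=
  (forall (a : Qp4) (A : set borel), measurable A ->
     mu [set x + a | x in (A : set Qp4)] = mu A)
  /\ mu [set x : Qp4 | vnorm x <= 1] = 1%E.

End Spacetime.

Section Distributions.
Variables (R : realType) (p : nat) (p_pr : prime p).
Variable mu : {measure set (borel p_pr) -> \bar R}.

Local Notation Qp := (padic p_pr).
Local Notation Qp4 := (Qp4 p_pr).
Local Notation Cplx := (Cplx R).

Implicit Types (f g phi psi : Qp4 -> Cplx) (T S : (Qp4 -> Cplx) -> Cplx).

Definition cintegral f : Cplx :=
  (Rintegral mu setT (fun x => complex.Re (f x))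
   +i* Rintegral mu setT (fun x => complex.Im (f x)))%C.

(* A distribution is given by a functional [T] on all functions, of which only
   the values on test functions matter: linearity is required, and equality is
   stated, on test functions only. *)
Definition distribution T : Prop :=
  forall (a : Cplx) phi psi, test_function phi -> test_function psi ->
    T (fun x => a * phi x + psi x) = a * T phi + T psi.

Definition eq_distribution T S : Prop :=
  forall phi, test_function phi -> T phi = S phi.

Definition distribution_of f : (Qp4 -> Cplx) -> Cplx :=
  fun phi => cintegral (fun x => f x * phi x).

Definition fourier phi : Qp4 -> Cplx :=
  fun k => cintegral (fun x => chi R (bracket x k) * phi x).

(* The inverse of [fourier] on test functions, since [bracket] is unimodular. *)
Definition inv_fourier phi : Qp4 -> Cplx :=
  fun x => cintegral (fun k => chi R (- bracket x k) * phi k).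

Definition dfourier T : (Qp4 -> Cplx) -> Cplx := fun phi => T (fourier phi).

Definition inv_dfourier T : (Qp4 -> Cplx) -> Cplx :=
  fun phi => T (inv_fourier phi).

Definition Omega (t : rat) : Cplx := \1_(`[0, 1]%classic : set rat) t.

Definition delta_seq (j : nat) : Qp4 -> Cplx :=
  fun x => p%:R ^+ (4 * j) * Omega (p%:R ^+ j * vnorm x).

Definition convolution T phi : Qp4 -> Cplx :=
  fun x => T (fun y => phi (x - y)).

Definition product_seq T S phi (j : nat) : Cplx :=
  S (fun x => convolution T (delta_seq j) x * phi x).

Definition product_exists T S : Prop :=
  forall phi, test_function phi -> cvgn (product_seq T S phi).

Definition product T S : (Qp4 -> Cplx) -> Cplx :=
  fun phi => limn (product_seq T S phi).

Definition symbol (alpha : R) (m : Qp) : Qp4 -> Cplx :=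
  fun k => ((ratr (pnorm (bracket k k - m ^+ 2)) : R) `^ alpha)%:C%C.

Definition box_domain (alpha : R) (m : Qp) T : Prop :=
  distribution T
  /\ product_exists (distribution_of (symbol alpha m)) (dfourier T).

Definition box (alpha : R) (m : Qp) T : (Qp4 -> Cplx) -> Cplx :=
  inv_dfourier (product (distribution_of (symbol alpha m)) (dfourier T)).

Definition weak_solution (alpha : R) (m : Qp) T S : Prop :=
  box_domain alpha m T /\ eq_distribution (box alpha m T) S.

End Distributions.

(* Main.v *)
Require Import Defs.
From HB Require Import structures.
From mathcomp Require Import all_boot all_order all_algebra.
From mathcomp Require Import complex.
From mathcomp Require Import ring lra zify.
From mathcomp Require Import all_classical all_reals all_analysis.
From mathcomp Require Import measurable_realfun.
Import Order.TTheory GRing.Theory Num.Theory.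
Import numFieldNormedType.Exports.
Local Open Scope classical_set_scope.
Local Open Scope ring_scope.

Set Implicit Arguments.
Unset Strict Implicit.
Unset Printing Implicit Defensive.

(** By Fourier inversion, the Fourier transform of the plane wave
    [x |-> chi [x, k]] is the Dirac mass at [-k]. Hence the product of the
    symbol with it, tested against [phi], is the limit of [s_j (-k) * phi (-k)],
    where [s_j] is the average of the symbol over balls of radius [p ^ (- j)].
    As [Q (-k) = m ^ 2], the symbol is [O(p ^ (- j * alpha))] on the ball
    around [-k], so this limit is [0].

    Fourier inversion reduces to the indicator of a ball [a + B_n], because
    test functions are finite linear combinations of those: the transform of
    the indicator of [B_n] is [mu B_n] times that of [B_(-n)], and
    [mu B_n * mu B_(-n) = 1] since [B_n] is the union of [p ^ 4] cosets of
    [B_(n+1)]. *)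

(** * Norms of integers and base-p digits in Q_p *)

Section PadicNumbers.
Variables (p : nat) (p_pr : prime p).
Local Notation Zp := (padic_int p_pr).
Local Notation Qp := (padic p_pr).
Local Notation "x %:F" := (@FracField.tofrac (padic_int p_pr) x).
Implicit Types (x y z : Qp) (a b : int).

Lemma ltr1p : 1 < p%:R :> rat.
Proof. by rewrite ltr1n prime_gt1. Qed.

Lemma padic_int_intE a : a%:~R = pint p_pr a :> Zp.
Proof.
have E n : n%:R = pint p_pr n :> Zp.
  elim: n => [//|n IH]; rewrite -natr1 IH; apply: padic_int_eqP => N.
  by rewrite !of_seqE modzDm -PoszD addn1.
case: a => n; first exact: E.
rewrite NegzE mulrNz -pmulrn E; apply: padic_int_eqP => N.
by rewrite !of_seqE modzNm.
Qed.

Lemma tofrac_int a : (a%:~R : Zp)%:F = a%:~R :> Qp.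
Proof. exact: rmorph_int. Qed.

Lemma residue_int a n : (a%:~R : Zp) n = (a %% p%:Z ^+ n)%Z.
Proof. by rewrite padic_int_intE. Qed.

Lemma pval_int a n : (a%:~R : Zp) != 0 ->
  (n <= pval (a%:~R : Zp))%N = (p%:Z ^+ n %| a)%Z.
Proof.
move=> a0; rewrite -(residue_eq0 a0 (leqnn n)) residue_int.
by apply/dvdz_mod0P/dvdz_mod0P; rewrite modz_mod.
Qed.

Lemma padic_int_int_eq0 a : ((a%:~R : Zp) == 0) = (a == 0).
Proof.
apply/eqP/eqP => [|->//] a0; apply/eqP/negPn/negP => na.
(* The residue modulo [p ^ |a|] decides, since [|a| < p ^ |a|]. *)
have /eqP := congr1 (fun u : Zp => u `|a|%N) a0.
rewrite residue_int padic_int0E => /eqP /dvdz_mod0P.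
rewrite dvdzE abszX absz_nat => /dvdn_leq; rewrite absz_gt0 na => /(_ isT).
by rewrite leqNgt ltn_expl// prime_gt1.
Qed.

Lemma padic_int_eq0 a : ((a%:~R : Qp) == 0) = (a == 0).
Proof. by rewrite -tofrac_int tofrac_eq0 padic_int_int_eq0. Qed.

Lemma pval1 : pval (1 : Zp) = 0%N.
Proof.
apply/eqP; rewrite -leqn0 leqNgt (@pval_int 1 1) ?oner_neq0//.
by rewrite dvdzE abszX absz_nat expn1 Euclid_dvd1.
Qed.

Lemma pnorm_int_le a n :
  (pnorm (a%:~R : Qp) <= p%:R ^ (- n%:Z)) = (p%:Z ^+ n %| a)%Z.
Proof.
have [->|a0] := eqVneq a 0.
  by rewrite pnorm0 dvdz0 exprz_ge0// ler0n.
rewrite /pnorm padic_int_eq0 (negbTE a0).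
have a0' : (a%:~R : Zp) != 0 by rewrite padic_int_int_eq0.
have -> : (a%:~R : Qp) = (a%:~R : Zp)%:F / (1 : Zp)%:F.
  by rewrite tofrac_int tofrac1 divr1.
rewrite ordE ?oner_neq0// pval1 subr0 -(pval_int n a0') ler_eXz2l ?ltr1p//.
by rewrite lerN2 lez_nat.
Qed.

Lemma pnorm_int_le1 a : pnorm (a%:~R : Qp) <= 1.
Proof. by have := pnorm_int_le a 0; rewrite expr0 dvd1z oppr0 expr0z. Qed.

Lemma pnorm_le_ord x (n : int) : x != 0 ->
  (pnorm x <= p%:R ^ n) = (- n <= ord x).
Proof. by move=> /negbTE x0; rewrite /pnorm x0 ler_eXz2l ?ltr1p// lerNl. Qed.

Lemma pnorm_lt_ord x (n : int) : x != 0 ->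
  (pnorm x < p%:R ^ n) = (- n < ord x).
Proof. by move=> /negbTE x0; rewrite /pnorm x0 ltr_eXz2l ?ltr1p// ltrNl. Qed.

(** The values of [pnorm] are 0 and the integral powers of p, so a strict bound drops the exponent
    by one. *)
Lemma pnorm_lt_le x (n : int) : (pnorm x < p%:R ^ n) = (pnorm x <= p%:R ^ (n - 1)).
Proof.
have [->|x0] := eqVneq x 0.
  by rewrite pnorm0 exprz_gt0 ?exprz_ge0 ?pR_gt0// ltW// pR_gt0.
by rewrite pnorm_lt_ord// pnorm_le_ord//; lia.
Qed.

Lemma pnorm1 : pnorm (1 : Qp) = 1.
Proof.
have := pnormM (1 : Qp) 1; rewrite mulr1 => /eqP.
rewrite -{1}[pnorm 1]mulr1 => /eqP/mulfI -> //.
by rewrite pnorm_eq0 oner_neq0.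
Qed.

Lemma pnormV x : pnorm x^-1 = (pnorm x)^-1.
Proof.
have [->|x0] := eqVneq x 0; first by rewrite invr0 pnorm0 invr0.
apply/(@mulfI _ (pnorm x)); first by rewrite pnorm_eq0.
by rewrite -pnormM !divff ?pnorm_eq0// pnorm1.
Qed.

Lemma p_neq0 : (p%:R : Qp) != 0.
Proof. by rewrite (@padic_int_eq0 p) eqz_nat -lt0n prime_gt0. Qed.

Lemma pnorm_p : pnorm (p%:R : Qp) = p%:R^-1.
Proof.
apply/le_anti/andP; split.
  by rewrite -exprN1 (pnorm_int_le p%:Z 1).
(* A smaller norm would be at most [p ^ (-2)], so that [p ^ 2] would divide p. *)
rewrite leNgt -exprN1 pnorm_lt_le -opprD (pnorm_int_le p%:Z 2).
rewrite dvdzE abszX absz_nat pfactor_dvdn ?prime_gt0//.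
by rewrite (@pfactorK p 1)// -[X in logn _ X]expn1 pfactorK.
Qed.

Lemma pnormX x (n : int) : pnorm (x ^ n) = pnorm x ^ n.
Proof.
have E (k : nat) : pnorm (x ^+ k) = pnorm x ^+ k.
  by elim: k => [|k IH]; rewrite ?expr0 ?pnorm1// !exprS pnormM IH.
by case: n => n; rewrite ?NegzE -?exprnN ?pnormV ?E// -!exprnP E.
Qed.

Lemma pnorm_pX (n : int) : pnorm ((p%:R : Qp) ^ n) = p%:R ^ (- n).
Proof. by rewrite pnormX pnorm_p exprz_inv. Qed.

Lemma pnorm_pXn n : pnorm ((p%:R : Qp) ^+ n) = p%:R ^ (- n%:Z).
Proof. by rewrite -pnorm_pX. Qed.

Lemma pnormD_le x y r : pnorm x <= r -> pnorm y <= r -> pnorm (x + y) <= r.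
Proof. by move=> xr yr; rewrite (le_trans (pnormD x y))// ge_max xr. Qed.

Lemma pnormB_le x y r : pnorm x <= r -> pnorm y <= r -> pnorm (x - y) <= r.
Proof. by move=> xr yr; apply: pnormD_le; rewrite ?pnormN. Qed.

(* Write [x = A / B] in Z_p: the digit [d] solves [A = d * B] modulo
   [p ^ (pval B + 1)]. *)
Lemma digit x : pnorm x <= 1 -> exists d : 'I_p, pnorm (x - (d : nat)%:R) < 1.
Proof.
have [->|x0] := eqVneq x 0.
  by exists (Ordinal (prime_gt0 p_pr)); rewrite subr0 pnorm0 ltr01.
rewrite -(expr0z (p%:R : rat)) pnorm_le_ord// oppr0.
have [[A B] /= [A0 B0 ->]] := padic_fracP x0.
rewrite ordE// => AB; set v := pval B.
have vA : (v <= pval A)%N by rewrite /v; lia.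
have := residue_eq0 A0 (leqnSn v); rewrite vA => /dvdzP[a aE].
have := residue_eq0 B0 (leqnSn v); rewrite leqnn => /dvdzP[b bE].
have pb : ~~ (p %| b)%Z.
  apply/negP => /dvdzP[c cE].
  have := residue_eq0 B0 (leqnn v.+1); rewrite ltnn bE cE -mulrA -exprS.
  by rewrite dvdz_mull.
have : coprimez b p.
  by rewrite coprimezE absz_nat coprime_sym prime_coprime.
move=> /coprimezP[[u w] /= uw].
pose j := (a * u %% p)%Z.
have j0 : 0 <= j by rewrite modz_ge0// eqz_nat -lt0n prime_gt0.
have jp : (`|j| < p)%N.
  by rewrite -ltz_nat gez0_abs// ltz_pmod// ltz_nat prime_gt0.
exists (Ordinal jp) => /=.
have jE : (`|j|%N%:R : Qp) = (j%:~R : Zp)%:F by rewrite tofrac_int -{2}(gez0_abs j0).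
have -> : A%:F / B%:F - `|j|%N%:R = (A - j%:~R * B)%:F / B%:F.
  by rewrite jE tofracB tofracM mulrBl mulfK ?tofrac_eq0.
have [->|AB0] := eqVneq (A - j%:~R * B) 0.
  by rewrite tofrac0 mul0r pnorm0 exprz_gt0 ?pR_gt0.
rewrite pnorm_lt_ord ?mulf_neq0 ?invr_neq0 ?tofrac_eq0// ordE// oppr0 subr_gt0.
rewrite ltz_nat -(residue_eq0 AB0 (leqnn _)).
apply/dvdz_mod0P; rewrite padic_intDE modz_mod -modzDmr padic_intNE modz_mod modzDmr.
rewrite -modzDmr -modzNm padic_intME modz_mod -modzMm residue_int modz_mod modzMm.
rewrite modzNm modzDmr aE bE mulrA -mulrBl; apply/dvdz_mod0P.
rewrite -/v exprS dvdz_mul2r ?pn_neq0//.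
apply/dvdz_mod0P; rewrite -modzDmr -modzNm -modzMml /j modz_mod modzMml modzNm modzDmr.
apply/dvdz_mod0P/dvdzP; exists (a * w).
by rewrite -[X in X - _]mulr1 -uw; ring.
Qed.

(** Two digits of the same x differ by an integer of norm < 1, that is by a multiple of p, and both
    are below p. *)
Lemma digit_inj (d e : 'I_p) x :
  pnorm (x - (d : nat)%:R) < 1 -> pnorm (x - (e : nat)%:R) < 1 -> d = e.
Proof.
rewrite -(expr0z (p%:R : rat)) !pnorm_lt_le => xd xe.
have := pnormB_le xe xd.
have -> : x - (e : nat)%:R - (x - (d : nat)%:R) = (d%:Z - e%:Z)%:~R.
  by rewrite rmorphB/= -!pmulrn; ring.
rewrite add0r (pnorm_int_le _ 1) expr1 -eqz_mod_dvd !modz_nat eqz_nat.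
by rewrite !modn_small// => /eqP/val_inj.
Qed.

(** The base-p expansion of x cut after n digits: subtract the lowest digit, divide by p and
    recurse. *)
Lemma approx_nat x n : pnorm x <= 1 ->
  exists a : nat, pnorm (x - a%:R) <= p%:R ^ (- n%:Z).
Proof.
elim: n x => [|n IH] x x1; first by exists 0%N; rewrite subr0 oppr0 expr0z.
have [d] := digit x1; rewrite -(expr0z (p%:R : rat)) pnorm_lt_le add0r => xd.
have : pnorm ((x - (d : nat)%:R) / p%:R) <= 1.
  rewrite pnormM pnormV pnorm_p invrK.
  by rewrite -ler_pdivlMr ?pR_gt0// div1r -exprN1.
move=> /IH[a xa]; exists (d + p * a)%N.
have -> : x - (d + p * a)%:R = p%:R * ((x - (d : nat)%:R) / p%:R - a%:R).
  by rewrite natrD natrM mulrBr mulrCA divff ?p_neq0// mulr1 opprD addrA.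
have -> : - n.+1%:Z = -1 - n%:Z by lia.
rewrite pnormM pnorm_p -exprN1 expfzDr ?gt_eqF ?pR_gt0//.
by rewrite ler_pM2l// exprz_gt0// pR_gt0.
Qed.

End PadicNumbers.

(** * Rational representatives and the fractional part *)

Section RationalPart.
Variables (p : nat) (p_pr : prime p).
Local Notation Qp := (padic p_pr).
Implicit Types (x y : Qp) (q : rat).

Lemma padic_ratr_frac (a d : int) : d != 0 ->
  ratr (a%:~R / d%:~R) = a%:~R / d%:~R :> Qp.
Proof.
move=> d0; rewrite /ratr; set q : rat := a%:~R / d%:~R.
apply/eqP; rewrite eqr_div ?padic_int_eq0 ?denq_neq0//.
rewrite -!intrM; apply/eqP; congr (_ %:~R).
apply/(@intr_inj rat); rewrite !intrM.
have : q = (numq q)%:~R / (denq q)%:~R by rewrite divq_num_den.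
rewrite {1}/q => /eqP; rewrite eqr_div ?intr_eq0 ?denq_neq0// => /eqP ->.
by [].
Qed.

Lemma padic_ratrD q q' : ratr (q + q') = ratr q + ratr q' :> Qp.
Proof.
rewrite -{1}(divq_num_den q) -{1}(divq_num_den q') addf_div ?intr_eq0 ?denq_neq0//.
rewrite -!intrM -intrD padic_ratr_frac ?mulf_neq0 ?denq_neq0//.
rewrite intrD !intrM /ratr addf_div ?padic_int_eq0 ?denq_neq0//.
Qed.

Lemma padic_ratrN q : ratr (- q) = - ratr q :> Qp.
Proof. by rewrite /ratr numqN denqN rmorphN mulNr. Qed.

Lemma padic_ratr0 : ratr 0 = 0 :> Qp.
Proof. by apply: (addrI (ratr 0)); rewrite -padic_ratrD !addr0. Qed.

(** The ring Z[1/p]: it contains all fractional parts and is closed under addition, as their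
    interval [0, 1) is not. *)
Definition pfrac q := exists (a : int) (n : nat), q = a%:~R / p%:R ^+ n.

Lemma pfracE q : pfrac q -> exists (a : int) (n : nat),
  q = a%:~R / p%:R ^+ n /\ ratr q = a%:~R / p%:R ^+ n :> Qp.
Proof.
move=> [a [n ->]]; exists a, n; split=> //.
rewrite -!natrX; have := @padic_ratr_frac a (p ^ n)%N.
by rewrite -!pmulrn; apply; rewrite eqz_nat -lt0n expn_gt0 prime_gt0.
Qed.

Lemma pfracD q q' : pfrac q -> pfrac q' -> pfrac (q + q').
Proof.
move=> [a [n ->]] [b [k ->]]; exists (a * p%:Z ^+ k + b * p%:Z ^+ n), (n + k)%N.
have pX i : (p%:R : rat) ^+ i != 0 by rewrite expf_neq0// gt_eqF// pR_gt0.
by rewrite addf_div// intrD !intrM !rmorphXn/= -exprD.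
Qed.

Lemma pfracN q : pfrac q -> pfrac (- q).
Proof. by move=> [a [n ->]]; exists (- a), n; rewrite intrN mulNr. Qed.

(** The intersection of Z[1/p] and Z_p is Z: [p ^ n] divides the numerator of a fraction of norm at
    most 1. *)
Lemma pfrac_int q : pfrac q -> pnorm (ratr q : Qp) <= 1 -> exists c : int, q = c%:~R.
Proof.
move=> /pfracE[a [n [-> ->]]].
rewrite pnormM pnormV pnorm_pXn ler_pdivrMr ?exprz_gt0 ?pR_gt0//.
rewrite mul1r pnorm_int_le => /dvdzP[c ->]; exists c.
by rewrite intrM rmorphXn mulfK// expf_neq0// gt_eqF// pR_gt0.
Qed.

Lemma fracpartP y : is_fracpart y (fracpart y).
Proof.
apply: xgetPex; have [->|y0] := eqVneq y 0.
  exists 0; split; rewrite ?lexx ?ltr01//; first by exists 0%N, 0%N; rewrite mul0r.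
  by rewrite padic_ratr0 subr0 pnorm0.
set n := `|ord y|%N.
have : pnorm (p%:R ^+ n * y) <= 1.
  rewrite pnormM pnorm_pXn /pnorm (negbTE y0).
  rewrite -expfzDr ?gt_eqF ?pR_gt0// -(expr0z (p%:R : rat)) ler_eXz2l ?ltr1p//.
  by rewrite /n; lia.
(* [a / p ^ n] differs from y by a p-adic integer; reducing a modulo [p ^ n] moves the fraction into
   [0, 1). *)
move=> /(approx_nat n)[a ya]; set b := (a %% p ^ n)%N.
have pn0 : (0 : rat) < (p ^ n)%:R by rewrite ltr0n expn_gt0 prime_gt0.
have pnQ : (p%:R ^+ n : Qp) != 0 := expf_neq0 n (p_neq0 p_pr).
exists (b%:R / p%:R ^+ n); split; last 2 first.
- by exists b, n.
- have -> : ratr (b%:R / p%:R ^+ n) = b%:R / p%:R ^+ n :> Qp.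
    rewrite -!natrX; have := @padic_ratr_frac b (p ^ n)%N.
    by rewrite -!pmulrn; apply; rewrite eqz_nat -lt0n expn_gt0 prime_gt0.
  have -> : y - b%:R / p%:R ^+ n =
      (p%:R ^+ n * y - a%:R + (a%:Z - b%:Z)%:~R) / p%:R ^+ n.
    rewrite rmorphB/= -!pmulrn addrA subrK mulrBl.
    by rewrite mulrAC mulfV// mul1r.
  rewrite pnormM pnormV pnorm_pXn.
  rewrite ler_pdivrMr ?exprz_gt0 ?pR_gt0// mul1r.
  apply: pnormD_le => //; rewrite pnorm_int_le -eqz_mod_dvd.
  by rewrite -rmorphXn/= !modz_nat modn_mod.
- rewrite -natrX divr_ge0 ?ler0n//= ltr_pdivrMr// mul1r ltr_nat.
  by rewrite ltn_mod expn_gt0 prime_gt0.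
Qed.

Lemma fracpart_pfrac y : pfrac (fracpart y).
Proof. by have [_ [a [n ->]] _] := fracpartP y; exists a, n. Qed.

End RationalPart.

(** * The additive character [chi] *)

Section AdditiveCharacter.
Variables (R : realType) (p : nat) (p_pr : prime p).
Local Notation Qp := (padic p_pr).
Local Notation Cplx := (Cplx R).
Implicit Types (x y : Qp) (q : rat).

Definition expi q : Cplx :=
  let t : R := 2 * pi * ratr q in (cos t +i* sin t)%C.

Lemma expiD q q' : expi (q + q') = expi q * expi q'.
Proof.
rewrite /expi rmorphD mulrDr cosD sinD; apply/eqP; rewrite eq_complex/=.
by rewrite eqxx/= addrC.
Qed.

Lemma expi_int (a : int) : expi a%:~R = 1.
Proof.
have E n : expi n%:R = 1.
  elim: n => [|n IH]; rewrite -?natr1 ?expiD ?IH ?mul1r /expi.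
    by rewrite ratr_nat mulr0 cos0 sin0.
  by rewrite rmorph1 mulr1 mulr_natl cos2pi sin2pi.
case: a => n; rewrite ?NegzE -?pmulrn ?E// mulrNz -pmulrn.
by rewrite -[LHS]mulr1 -(E n.+1) -expiD addNr (E 0%N).
Qed.

(** Two elements of Z[1/p] that approximate y modulo Z_p differ by an integer, on which [expi] is 1.
    So [chi] can be computed from any of them, not only from the one in [0, 1). *)
Lemma chi_eq y q : pfrac p q -> pnorm (y - ratr q) <= 1 -> chi R y = expi q.
Proof.
move=> qf yq; have [_ _ yq0] := fracpartP y.
have q0f := pfracD p_pr (fracpart_pfrac y) (pfracN qf).
have [|c cE] := pfrac_int (p_pr := p_pr) q0f.
  rewrite padic_ratrD padic_ratrN.
  have E (V : zmodType) (a b c : V) : a - b = (c - b) - (c - a).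
    by rewrite opprB [RHS]addrC addrA subrK.
  rewrite (E _ _ _ y).
  exact: pnormB_le.
by rewrite /chi -/(expi _) -[fracpart y](subrK q) cE expiD expi_int mul1r.
Qed.

(** The sum of two fractional parts may leave [0, 1), but it remains an admissible representative in
    [chi_eq]. *)
Lemma chiD x y : chi R (x + y) = chi R x * chi R y.
Proof.
rewrite (@chi_eq (x + y) (fracpart x + fracpart y)) ?expiD//.
  by apply: pfracD => //; exact: fracpart_pfrac.
have [_ _ xq] := fracpartP x; have [_ _ yq] := fracpartP y.
have E (V : zmodType) (a b c d : V) : a + b - (c + d) = (a - c) + (b - d).
  by rewrite opprD addrACA.
rewrite padic_ratrD E.
by apply: pnormD_le; [exact: xq|exact: yq].
Qed.

Lemma chi_eq1 y : pnorm y <= 1 -> chi R y = 1.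
Proof.
move=> y1; rewrite (@chi_eq y 0) ?(expi_int 0)//; first by exists 0, 0%N; rewrite mul0r.
by rewrite padic_ratr0 subr0.
Qed.

(* [1 - cos t = 2 (sin (t / 2)) ^ 2] with [0 < t < 2 pi]. *)
Lemma chi_pV : chi R (p%:R^-1 : Qp) != 1.
Proof.
have [/andP[q0 q1] _ yq] := fracpartP (p%:R^-1 : Qp).
rewrite /chi; set q := fracpart _ in q0 q1 yq *.
have {}q0 : 0 < q.
  rewrite lt_neqAle q0 andbT; apply: contraTneq yq => <-.
  by rewrite padic_ratr0 subr0 pnormV pnorm_p invrK -ltNge ltr1p.
have s0 : 0 < sin (pi * ratr q : R).
  rewrite sin_gt0_pi// mulr_gt0 ?pi_gt0 ?ltr0q//=.
  by rewrite gtr_pMr ?pi_gt0// -(rmorph1 (@ratr R)) ltr_rat.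
rewrite eq_complex negb_and/=; apply/orP; left.
rewrite -mulrA [2 * _]mulr_natl mulr2n cosD -!expr2 cos2sin2.
apply: contraTneq s0 => h; rewrite -leNgt.
have : sin (pi * ratr q : R) ^+ 2 = 0 by lra.
by move/eqP; rewrite sqrf_eq0 => /eqP ->.
Qed.

End AdditiveCharacter.

(** * Balls of Q_p^4 and their duality under [bracket] *)

Section Balls.
Variables (p : nat) (p_pr : prime p).
Local Notation Qp := (padic p_pr).
Local Notation Qp4 := (Qp4 p_pr).
Implicit Types (x y k h a : Qp4) (n m : int).

(* [None] is the time coordinate. *)
Definition coordinate x (i : option 'I_3) : Qp := if i is Some j then x.2 0 j else x.1.

Definition of_coord (f : option 'I_3 -> Qp) : Qp4 := (f None, \row_j f (Some j)).

Lemma of_coordK f i : coordinate (of_coord f) i = f i.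
Proof. by case: i => [j|//]; rewrite /= mxE. Qed.

Lemma coordD x y i : coordinate (x + y) i = coordinate x i + coordinate y i.
Proof. by case: i => [j|//] /=; rewrite mxE. Qed.

Lemma coordN x i : coordinate (- x) i = - coordinate x i.
Proof. by case: i => [j|//] /=; rewrite mxE. Qed.

Lemma coordB x y i : coordinate (x - y) i = coordinate x i - coordinate y i.
Proof. by rewrite coordD coordN. Qed.

Lemma coord0 i : coordinate (0 : Qp4) i = 0.
Proof. by case: i => [j|//] /=; rewrite mxE. Qed.

(** The ball [B_n], an additive subgroup; n is minus the exponent of the radius, so the balls shrink
    as n grows. *)
Definition inB n x : bool := vnorm x <= p%:R ^ (- n).

Lemma vnorm_le x (r : rat) : 0 <= r ->
  reflect (forall i, pnorm (coordinate x i) <= r) (vnorm x <= r).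
Proof.
move=> r0; rewrite /vnorm ge_max; apply: (iffP andP) => [[h /bigmax_leP[_ H]] [j|]//|H].
  exact: H.
split; first exact: (H None).
by apply/bigmax_leP; split=> // j _; apply: (H (Some j)).
Qed.

Lemma inBP n x : reflect (forall i, pnorm (coordinate x i) <= p%:R ^ (- n)) (inB n x).
Proof. by apply: vnorm_le; rewrite exprz_ge0// ler0n. Qed.

Lemma inBD n x y : inB n x -> inB n y -> inB n (x + y).
Proof.
by move=> /inBP xn /inBP yn; apply/inBP => i; rewrite coordD; apply: pnormD_le.
Qed.

Lemma inBN n x : inB n (- x) = inB n x.
Proof. by apply/inBP/inBP => h i; have := h i; rewrite coordN pnormN. Qed.

Lemma inBDr n x y : inB n y -> inB n (x + y) = inB n x.
Proof.
move=> yn; apply/idP/idP => [xyn|xn]; last exact: inBD.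
by rewrite -(addrK y x) inBD ?inBN.
Qed.

Lemma inBW m n x : m <= n -> inB n x -> inB m x.
Proof.
move=> mn /le_trans; apply.
by rewrite ler_weXz2l ?lerN2// ler1n prime_gt0.
Qed.

Lemma inB_exists x : exists n : nat, inB (- n%:Z) x.
Proof.
pose N := \max_i `|ord (coordinate x i)|%N; exists N; apply/inBP => i.
have [->|x0] := eqVneq (coordinate x i) 0; first by rewrite pnorm0 exprz_ge0// ler0n.
rewrite pnorm_le_ord//; have := @leq_bigmax _ (fun i => `|ord (coordinate x i)|%N) i.
by rewrite -/N; lia.
Qed.

Lemma bracketC x y : bracket x y = bracket y x.
Proof.
rewrite /bracket /dot mulrC; congr (_ - _); apply: eq_bigr => i _; exact: mulrC.
Qed.

Lemma bracketDl x y k : bracket (x + y) k = bracket x k + bracket y k.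
Proof.
rewrite /bracket /dot mulrDl.
have -> : \sum_(i < 3) (x + y).2 0 i * k.2 0 i =
    \sum_(i < 3) x.2 0 i * k.2 0 i + \sum_(i < 3) y.2 0 i * k.2 0 i.
  rewrite -big_split; apply: eq_bigr => i _ /=.
  by rewrite mxE mulrDl.
by rewrite opprD addrACA.
Qed.

Lemma bracketNl x k : bracket (- x) k = - bracket x k.
Proof.
apply: (addIr (bracket x k)); rewrite -bracketDl !addNr.
by apply: (addIr (bracket 0 k)); rewrite -bracketDl addr0 add0r.
Qed.

Lemma bracketDr x y k : bracket k (x + y) = bracket k x + bracket k y.
Proof. by rewrite bracketC bracketDl ![bracket _ k]bracketC. Qed.

Lemma bracketNr x k : bracket k (- x) = - bracket k x.
Proof. by rewrite bracketC bracketNl bracketC. Qed.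

(** Each product of coordinates obeys the bound, and the ultrametric inequality keeps it for their
    sum. For [m = - n] it is 1, where [chi] is trivial. *)
Lemma pnorm_bracket_le x y n m : inB n x -> inB m y ->
  pnorm (bracket x y) <= p%:R ^ (- (n + m)).
Proof.
move=> /inBP xn /inBP ym.
have H i : pnorm (coordinate x i * coordinate y i) <= p%:R ^ (- (n + m)).
  rewrite pnormM opprD expfzDr ?gt_eqF ?pR_gt0//.
  by apply: ler_pM; rewrite ?pnorm_ge0.
apply: pnormB_le; first exact: (H None).
apply: (big_ind (fun u => pnorm u <= p%:R ^ (- (n + m)))).
- by rewrite pnorm0 exprz_ge0// ler0n.
- by move=> u v; exact: pnormD_le.
- by move=> i _; exact: (H (Some i)).
Qed.

(** The other half of the duality: only [B_(-n)] annihilates [B_n] under [chi]. A coordinate of k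
    that is too large is met by a vector along the same axis. *)
Lemma inB_dual n k : ~~ inB (- n) k ->
  exists2 x, inB n x & bracket x k = p%:R^-1.
Proof.
move=> H; have [i ki] : exists i, ~~ (pnorm (coordinate k i) <= p%:R ^ n).
  apply/not_existsP => h; move/negP: H; apply; apply/inBP => i.
  by apply/negPn/negP; rewrite opprK; exact: h.
rewrite -ltNge in ki.
have ki0 : coordinate k i != 0.
  by apply: contraTneq ki => ->; rewrite pnorm0 -leNgt exprz_ge0// ler0n.
(* The sign offsets the minus sign of the spatial part of [bracket]. *)
pose c : Qp := (if i is Some _ then - 1 else 1) * (p%:R^-1 / coordinate k i).
have cn : pnorm c <= p%:R ^ (- n).
  have -> : pnorm c = p%:R * (pnorm (coordinate k i))^-1.
    rewrite /c pnormM !pnormM !pnormV pnorm_p invrK.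
    by case: (i) => [j|]; rewrite ?pnormN pnorm1 mul1r.
  (* [|k_i| > p ^ n] means [|k_i| >= p ^ (n + 1)], which absorbs the factor p coming from the norm
     of [p^-1]. *)
  move: ki; rewrite /pnorm (negbTE ki0) ltr_eXz2l ?ltr1p// => ki.
  rewrite invr_expz opprK -{1}(expr1z p%:R) -expfzDr ?gt_eqF ?pR_gt0//.
  by rewrite ler_eXz2l ?ltr1p//; lia.
exists (of_coord (fun j => if j == i then c else 0)).
  apply/inBP => j; rewrite of_coordK; case: eqP => // _.
  by rewrite pnorm0 exprz_ge0// ler0n.
rewrite /bracket /dot /=; case: i ki0 @c cn {ki} => [i|] ki0 c cn /=.
  rewrite mul0r sub0r (bigD1 i)//= big1 => [|j /negbTE ji]; last first.
    by rewrite mxE (inj_eq Some_inj) ji mul0r.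
  rewrite mxE eqxx addr0 /c mulN1r mulNr opprK.
  by rewrite mulfVK.
rewrite big1 => [|j _]; last by rewrite mxE mul0r.
by rewrite subr0 /c mul1r mulfVK.
Qed.

(* Representatives of the cosets of [B_(n+1)] in [B_n]. *)
Definition coset_rep n (d : {ffun option 'I_3 -> 'I_p}) : Qp4 :=
  of_coord (fun i => p%:R ^ n * (d i : nat)%:R).

Lemma inB_digit n x (i : option 'I_3) (d : 'I_p) :
  (pnorm (coordinate x i - p%:R ^ n * (d : nat)%:R) <= p%:R ^ (- (n + 1))) =
  (pnorm (coordinate x i / p%:R ^ n - (d : nat)%:R) < 1).
Proof.
have pn0 : (p%:R ^ n : Qp) != 0 by apply: expfz_neq0; exact: p_neq0.
rewrite -[X in X - _](divfK pn0) [X in X - _]mulrC -mulrBr pnormM pnorm_pX.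
rewrite opprD expfzDr ?gt_eqF ?pR_gt0// ler_pM2l ?exprz_gt0 ?pR_gt0//.
by rewrite -[X in _ < X](expr0z (p%:R : rat)) pnorm_lt_le add0r.
Qed.

Lemma coset_rep_in n d : inB n (coset_rep n d).
Proof.
apply/inBP => i; rewrite of_coordK pnormM pnorm_pX.
by rewrite ler_piMr ?exprz_ge0 ?ler0n// pmulrn pnorm_int_le1.
Qed.

Lemma coset_rep_exists n x : inB n x -> exists d, inB (n + 1) (x - coset_rep n d).
Proof.
move=> /inBP xn.
have H i : exists d : 'I_p,
    pnorm (coordinate x i - p%:R ^ n * (d : nat)%:R) <= p%:R ^ (- (n + 1)).
  have [|d dP] := @digit _ p_pr (coordinate x i / p%:R ^ n).
    rewrite pnormM pnormV pnorm_pX ler_pdivrMr ?exprz_gt0 ?pR_gt0// mul1r.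
    exact: xn.
  by exists d; rewrite inB_digit.
have [d dP] := choice H.
exists (finfun d); apply/inBP => i; rewrite coordB of_coordK ffunE; exact: dP.
Qed.

Lemma coset_rep_inj n x d e :
  inB (n + 1) (x - coset_rep n d) -> inB (n + 1) (x - coset_rep n e) -> d = e.
Proof.
move=> /inBP xd /inBP xe; apply/ffunP => i.
have := xd i; have := xe i; rewrite !coordB !of_coordK !inB_digit => ei di.
exact: digit_inj di ei.
Qed.

End Balls.

(** * The topology of Q_p^4 in terms of balls *)

Section Topology.
Variables (p : nat) (p_pr : prime p).
Local Notation Qp := (padic p_pr).
Local Notation Qp4 := (Qp4 p_pr).
Implicit Types (x y h a : Qp4) (n : int).

Lemma exists_pXN_lt (e : rat) : 0 < e -> exists n : nat, p%:R ^ (- n%:Z) < e.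
Proof.
(* [p ^ n > n > 1 / e] for this n. *)
move=> e0; exists (Num.trunc e^-1).+1.
rewrite -invr_expz invf_plt ?posrE ?exprz_gt0 ?pR_gt0//.
rewrite (lt_trans (truncnS_gt _))// -exprnP -natrX ltr_nat.
by rewrite ltn_expl// prime_gt1.
Qed.

Lemma ballE4 x y (e : rat) : 0 < e ->
  ball x e y <-> forall i, pnorm (coordinate (y - x) i) < e.
Proof.
have sym i : pnorm (coordinate (y - x) i) = pnorm (coordinate x i - coordinate y i).
  by rewrite coordB -pnormN opprB.
move=> e0; split=> [[xy1 [_ xy2]] i|xy].
  by rewrite sym; case: i => [j|]; [exact: (xy2 0 j)|exact: xy1].
split; first by have := xy None; rewrite sym.
by split=> // i j; have := xy (Some j); rewrite sym (ord1 i).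
Qed.

(** As [p ^ (- n)] tends to 0, the subgroups [B_n] are a basis of neighbourhoods of 0, which turns
    topological arguments into subgroup arithmetic. *)
Lemma nbhs_inBP x (A : set Qp4) :
  nbhs x A <-> exists n : nat, forall h, inB n h -> A (x + h).
Proof.
split=> [/nbhs_ballP[e /= e0 xA]|[n xA]].
  have [n ne] := exists_pXN_lt e0; exists n => h /inBP hn; apply: xA.
  apply/(ballE4 _ _ e0) => i; rewrite addrC addKr.
  exact: le_lt_trans (hn i) ne.
have e0 : (0 : rat) < p%:R ^ (- n%:Z) by rewrite exprz_gt0 ?pR_gt0.
apply/nbhs_ballP; exists (p%:R ^ (- n%:Z)) => // y /(ballE4 _ _ e0) xy;
  rewrite -(subrK x y) addrC; apply: xA.
by apply/inBP => i; rewrite ltW.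
Qed.

Lemma open_inB a n : open [set x | inB n (x - a)].
Proof.
rewrite openE => x /= xn; apply/nbhs_inBP; exists `|n|%N => h hn /=.
rewrite addrAC inBDr//; apply: inBW hn; lia.
Qed.

Lemma open_borel (A : set Qp4) : open A -> measurable (A : set (borel p_pr)).
Proof. by move=> oA; apply: sub_sigma_algebra. Qed.

Definition coset a n : set (borel p_pr) := [set x : Qp4 | inB n (x - a)].

Lemma measurable_coset a n : measurable (coset a n).
Proof. by apply: open_borel; exact: open_inB. Qed.

End Topology.

(** * Haar measure of balls *)

Section Haar.
Variables (R : realType) (p : nat) (p_pr : prime p).
Variable mu : {measure set (borel p_pr) -> \bar R}.
Hypothesis mu_haar : normalized_haar mu.
Local Notation Qp4 := (Qp4 p_pr).
Implicit Types (x y h a : Qp4) (n : int).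

Lemma haar_coset a n : mu (coset a n) = mu (coset 0 n).
Proof.
have [+ _] := mu_haar => /(_ a _ (measurable_coset 0 n)) <-; congr (mu _).
apply/seteqP; split => [x /= xa|_ [x /= xn <-]]; last first.
  by rewrite /coset/= addrK; rewrite /coset/= subr0 in xn.
by exists (x - a); rewrite ?subrK// /coset/= subr0.
Qed.

Lemma haar_ballS n : (mu (coset 0%R n) = (p ^ 4)%:R%:E * mu (coset 0%R (n + 1)%R))%E.
Proof.
have -> : coset (0 : Qp4) n =
    \bigcup_(d in [set` predT]) coset (coset_rep p_pr n d) (n + 1).
  apply/seteqP; split=> [x /=|x [d _ /= xd]].
    by rewrite /coset/= subr0 => /coset_rep_exists[d xd]; exists d.
  rewrite /coset/= subr0 -(subrK (coset_rep p_pr n d) x) inBDr ?coset_rep_in//.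
  by apply: inBW xd; lia.
rewrite measure_fin_bigcup//; last 2 first.
- move=> d e _ _ [x [xd xe]]; exact: coset_rep_inj xd xe.
- by move=> d _; exact: measurable_coset.
rewrite -(@bigfs _ _ _ _ (index_enum _))/= ?index_enum_uniq//; last first.
  by move=> d _; rewrite mem_index_enum.
under eq_bigr do rewrite haar_coset.
by rewrite mule_natl sumr_const card_ffun card_option !card_ord.
Qed.

Definition vol n : R := p%:R ^ (- (4 * n)).

Lemma volS n : vol n = (p ^ 4)%:R * vol (n + 1).
Proof.
rewrite /vol natrX exprnP -expfzDr ?pnatr_eq0 -?lt0n ?prime_gt0//.
by congr (_ ^ _); lia.
Qed.

(** The normalization fixes the case [n = 0]; [haar_ballS] then carries it to smaller balls by
    division and to larger ones by multiplication. *)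
Lemma haar_ball a n : mu (coset a n) = (vol n)%:E.
Proof.
rewrite haar_coset; have p4 : ((p ^ 4)%:R : R) != 0.
  by rewrite pnatr_eq0 -lt0n expn_gt0 prime_gt0.
have base : mu (coset 0 0) = (vol 0)%:E.
  have -> : vol 0 = 1 by rewrite /vol mulr0 oppr0 expr0z.
  have [_ <-] := mu_haar.
  by congr (mu _); apply/seteqP; split => x; rewrite /coset /= subr0 /inB oppr0 expr0z.
(* Multiplying by [r^-1] solves for [z] even before its finiteness is known. *)
have cancel (r v : R) (z : \bar R) : r != 0 -> (r%:E * z = (r * v)%:E -> z = v%:E)%E.
  move=> r0 E; rewrite -[z]mul1e -(mulVf r0) EFinM -muleA E -EFinM mulrA mulVf//.
  by rewrite mul1r.
case: n => n; last rewrite NegzE; elim: n => [|n IH].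
- exact: base.
- have -> : n.+1%:Z = n%:Z + 1 by lia.
  by apply: (cancel _ _ _ p4); rewrite -haar_ballS -volS.
- by rewrite haar_ballS volS addNr base -EFinM.
- rewrite haar_ballS volS; have -> : - n.+2%:Z + 1 = - n.+1%:Z by lia.
  by rewrite IH -EFinM.
Qed.

End Haar.

(** * Test functions as combinations of indicators of cosets *)

Section Schwartz.
Variables (R : realType) (p : nat) (p_pr : prime p).
Local Notation Qp4 := (Qp4 p_pr).
Local Notation Cplx := (Cplx R).
Implicit Types (x y h k a : Qp4) (n m : int) (f g : Qp4 -> Cplx).

Definition loc_const n f := forall x h, inB n h -> f (x + h) = f x.

Definition supported a n f := forall x, ~~ inB n (x - a) -> f x = 0.

(** A quantitative form of test functions: a single N bounds the support and gives a uniform radius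
    of constancy. *)
Definition schwartz f := exists N : nat, loc_const N f /\ supported 0 (- N%:Z) f.

Definition coset_fun a n : Qp4 -> Cplx := fun x => (inB n (x - a))%:R.

Lemma loc_constW n m f : n <= m -> loc_const n f -> loc_const m f.
Proof. by move=> nm fn x h hm; apply: fn; exact: inBW hm. Qed.

Lemma loc_constM n f g : loc_const n f -> loc_const n g ->
  loc_const n (fun x => f x * g x).
Proof. by move=> fn gn x h hn; rewrite fn ?gn. Qed.

Lemma loc_const_coset_fun a n : loc_const n (coset_fun a n).
Proof. by move=> x h hn; rewrite /coset_fun addrAC (inBDr _ hn). Qed.

Lemma supported0 n f : supported 0 n f <-> forall x, ~~ inB n x -> f x = 0.
Proof. by split=> fn x; have := fn x; rewrite subr0. Qed.

Lemma coset_decomposition a n f x : supported a n f ->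
  f x = \sum_d f x * coset_fun (a + coset_rep p_pr n d) (n + 1) x.
Proof.
move=> fn; have [xn|/fn ->] := boolP (inB n (x - a)); last first.
  by rewrite big1// => d _; rewrite mul0r.
have [d xd] := coset_rep_exists xn.
rewrite (bigD1 d)//= big1 => [|e ed]; rewrite /coset_fun opprD addrA.
  by rewrite xd mulr1 addr0.
case: (boolP (inB _ _)) => [xe|]; last by rewrite mulr0.
by rewrite (coset_rep_inj xe xd) eqxx in ed.
Qed.

(** Linear statements reduce to indicators of cosets: a ball is cut into cosets of smaller balls
    until the function is constant on each. *)
Lemma schwartz_ind (K : (Qp4 -> Cplx) -> Prop) :
  (forall a n, K (coset_fun a n)) ->
  (forall c f g, K f -> K g -> K (fun x => c * f x + g x)) ->
  forall f, schwartz f -> K f.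
Proof.
move=> K1 KD; have K0 : K (fun=> 0).
  suff -> : (fun=> 0) = (fun x => - 1 * coset_fun 0 0 x + coset_fun 0 0 x) by exact: KD.
  by apply/funext => x; rewrite mulN1r addNr.
have Ksum (I : Type) (s : seq I) (F : I -> Qp4 -> Cplx) :
    (forall i, K (F i)) -> K (fun x => \sum_(i <- s) F i x).
  move=> KF; elim: s => [|i s IH].
    by under eq_fun do rewrite big_nil.
  suff -> : (fun x => \sum_(j <- i :: s) F j x) =
      (fun x => 1 * F i x + \sum_(j <- s) F j x) by exact: KD.
  by apply/funext => x; rewrite big_cons mul1r.
(* Induction on the gap k between the scale of the support and the scale of constancy; one cut into
   [p ^ 4] cosets lowers it by one. *)
have Kk (k : nat) : forall a n f, loc_const (n + k%:Z) f -> supported a n f -> K f.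
  elim: k => [|k IH] a n f fl fn.
    suff -> : f = (fun x => f a * coset_fun a n x + 0) by exact: KD.
    apply/funext => x; rewrite addr0 /coset_fun.
    have [xn|/fn ->] := boolP (inB n (x - a)); last by rewrite mulr0.
    by rewrite mulr1 -[in LHS](subrK a x) addrC fl// addr0.
  suff -> : f = fun x => \sum_d f x * coset_fun (a + coset_rep p_pr n d) (n + 1) x.
    apply: Ksum => d; apply: IH (a + coset_rep p_pr n d) (n + 1) _ _ _.
      apply: loc_constM; first by apply: loc_constW fl; lia.
      by apply: (@loc_constW (n + 1)); [lia|exact: loc_const_coset_fun].
    by move=> x /negbTE xn; rewrite /coset_fun xn mulr0.
  by apply/funext => x; exact: coset_decomposition.
(* From the scale [- N] of the support to the scale N of constancy there are [N + N] cuts. *)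
move=> f [N [fl fs]]; apply: (Kk (N + N)%N 0 (- N%:Z)) => //.
by apply: loc_constW fl; lia.
Qed.

Lemma schwartzW f n m : loc_const n f -> supported 0 m f -> schwartz f.
Proof.
move=> fl fs; exists (`|n| + `|m|)%N; split; first by apply: loc_constW fl; lia.
by move=> x xm; apply: fs; apply: contra xm; apply: inBW; lia.
Qed.

Lemma schwartzMl n f g : loc_const n g -> schwartz f -> schwartz (fun x => g x * f x).
Proof.
move=> gn [N [fl fs]].
apply: (@schwartzW _ (N%:Z + `|n|%N%:Z) (- N%:Z)).
  by apply: loc_constM; [apply: loc_constW gn|apply: loc_constW fl]; lia.
by move=> x /fs ->; rewrite mulr0.
Qed.

Lemma schwartzD c f g : schwartz f -> schwartz g -> schwartz (fun x => c * f x + g x).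
Proof.
move=> [N [fl fs]] [M [gl gs]].
apply: (@schwartzW _ (N%:Z + M%:Z) (- (N%:Z + M%:Z))).
  by move=> x h hn; rewrite fl ?gl//; apply: inBW hn; lia.
move=> x xn; rewrite fs ?gs ?mulr0 ?addr0//; apply: contra xn; apply: inBW; lia.
Qed.

Lemma schwartz_translate a f : schwartz f -> schwartz (fun x => f (x + a)).
Proof.
move=> [N [fl fs]]; have [M aM] := inB_exists a.
apply: (@schwartzW _ N%:Z (- (N%:Z + M%:Z))).
  by move=> x h hn; rewrite addrAC; exact: fl.
move=> x xn; apply: fs; rewrite !subr0 in xn *; apply: contra xn => xa.
by rewrite -(addrK a x) inBD ?inBN//; [apply: inBW xa|apply: inBW aM]; lia.
Qed.

Lemma schwartz_coset_fun a n : schwartz (coset_fun a n).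
Proof.
suff -> : coset_fun a n = (fun x => coset_fun 0 n (x + - a)).
  apply: (@schwartz_translate (- a) (coset_fun 0 n)).
  apply: (@schwartzW _ n n); first exact: loc_const_coset_fun.
  by move=> x /negbTE xn; rewrite /coset_fun xn.
by apply/funext => x; rewrite /coset_fun subr0.
Qed.

Lemma chi_bracket_eq1 n x k : inB n x -> inB (- n) k -> chi R (bracket x k) = 1.
Proof.
move=> xn kn; apply: chi_eq1.
by have := pnorm_bracket_le xn kn; rewrite subrr oppr0 expr0z.
Qed.

Lemma loc_const_chi n k : inB (- n) k -> loc_const n (fun x => chi R (bracket x k)).
Proof. by move=> kn x h hn; rewrite bracketDl chiD (chi_bracket_eq1 hn kn) mulr1. Qed.

Lemma schwartz_chi k f : schwartz f -> schwartz (fun x => chi R (bracket x k) * f x).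
Proof.
have [n kn] := inB_exists k; apply: (@schwartzMl n%:Z).
exact: loc_const_chi.
Qed.

(** Compactness of the support, in its near-covering form, makes the pointwise radii uniform. *)
Lemma test_function_schwartz f : test_function f -> schwartz f.
Proof.
move=> [fl /compact_near_coveringP fK].
pose P (n : nat) x := (forall h, inB n h -> f (x + h) = f x) /\ inB (- n%:Z) x.
have : \forall n \near \oo, closure [set x | f x != 0] `<=` P n.
  apply: fK => x _.
  have /nbhs_inBP[n1 xn1] := fl x; have [n2 xn2] := inB_exists x.
  (* If y lies in [x + B_n1], then [y + B_n1 = x + B_n1]: the radius found at x serves for all
     nearby y. *)
  exists ([set y | inB (n1 + n2)%N (y - x)], [set i | (n1 + n2 <= i)%N]).
    split=> /=; last by exists (n1 + n2)%N.
    by apply/nbhs_inBP; exists (n1 + n2)%N => h hn /=; rewrite addrAC subrr add0r.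
  move=> [y i] /= [yx ni]; split=> [h hi|].
    have {1}-> : y + h = x + (y - x + h) by rewrite addrA subrKC.
    have yE : y = x + (y - x) by rewrite subrKC.
    rewrite xn1; last by apply: inBD; [apply: inBW yx|apply: inBW hi]; lia.
    by rewrite [in RHS]yE xn1//; apply: inBW yx; lia.
  by rewrite -(subrK x y) inBD//; [apply: inBW yx|apply: inBW xn2]; lia.
move=> [N _ /(_ N (leqnn N)) fN'].
have fN x : f x != 0 -> P N x by move=> fx; apply: fN'; exact: subset_closure.
exists N; split; last first.
  move=> x; rewrite subr0; apply: contraNeq => fx.
  by have [] := fN x fx.
move=> x h hN; have [fx|fx] := eqVneq (f x) 0; last first.
  by have [+ _] := fN x fx => ->.
(* At a zero x of f, a nonzero value at [x + h] would spread back to x by constancy around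
   [x + h]. *)
apply/eqP/negPn/negP; rewrite fx => fxh.
have [+ _] := fN _ fxh => /(_ (- h)).
by rewrite inBN addrK fx => /(_ hN) fxh0; rewrite -fxh0 eqxx in fxh.
Qed.

End Schwartz.

(** * Integration and Fourier inversion on test functions *)

Section Integral.
Variables (R : realType) (p : nat) (p_pr : prime p).
Variable mu : {measure set (borel p_pr) -> \bar R}.
Hypothesis mu_haar : normalized_haar mu.
Local Notation Qp4 := (Qp4 p_pr).
Local Notation Cplx := (Cplx R).
Implicit Types (x y h k a : Qp4) (n m : int) (f g : Qp4 -> Cplx).

Definition cintegrable f :=
  mu.-integrable setT (fun x => (complex.Re (f x))%:E) /\
  mu.-integrable setT (fun x => (complex.Im (f x))%:E).

Lemma integrable_coset a n : mu.-integrable setT (EFin \o \1_(coset a n)).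
Proof.
apply/integrableP; split.
  by apply/measurable_EFinP; apply: measurable_indic; exact: measurable_coset.
under eq_integral do rewrite /= ger0_norm//.
rewrite integral_indic//; last exact: measurable_coset.
by rewrite setIT (haar_ball mu_haar) ltry.
Qed.

Lemma Re_coset_fun a n x : complex.Re (coset_fun R a n x) = \1_(coset a n) x.
Proof.
rewrite /coset_fun indicE; have -> : (x \in coset a n) = inB n (x - a).
  by apply/idP/idP => [/set_mem|h]; [|apply/mem_set].
by case: inB.
Qed.

Lemma Im_coset_fun a n x : complex.Im (coset_fun R a n x) = 0.
Proof. by rewrite /coset_fun; case: inB. Qed.

Lemma cintegrable_coset_fun a n : cintegrable (coset_fun R a n).
Proof.
split; last first.
  by under eq_fun do rewrite Im_coset_fun; exact: integrable0.
by under eq_fun do rewrite Re_coset_fun; exact: integrable_coset.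
Qed.

Lemma Rintegral_coset a n : Rintegral mu setT \1_(coset a n) = vol R p n.
Proof.
rewrite /Rintegral integral_indic//; last exact: measurable_coset.
by rewrite setIT (haar_ball mu_haar).
Qed.

Lemma cintegral_coset_fun a n : cintegral mu (coset_fun R a n) = (vol R p n)%:C%C.
Proof.
rewrite /cintegral; under eq_fun do rewrite Re_coset_fun.
under [X in (_ +i* Rintegral _ _ X)%C]eq_fun do rewrite Im_coset_fun.
by rewrite Rintegral_coset /Rintegral integral0.
Qed.

Lemma cintegrableD c f g : cintegrable f -> cintegrable g ->
  cintegrable (fun x => c * f x + g x).
Proof.
case: c => a b [rf jf] [rg jg]; split.
- have -> : (fun x => (complex.Re ((a +i* b)%C * f x + g x))%:E) =
    (fun x => a%:E * (complex.Re (f x))%:E - b%:E * (complex.Im (f x))%:E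
              + (complex.Re (g x))%:E)%E.
    by apply/funext => x; case: (f x) (g x) => [u v] [w z].
  by apply: integrableD => //; apply: integrableB => //; exact: integrableZl.
- have -> : (fun x => (complex.Im ((a +i* b)%C * f x + g x))%:E) =
    (fun x => a%:E * (complex.Im (f x))%:E + b%:E * (complex.Re (f x))%:E
              + (complex.Im (g x))%:E)%E.
    by apply/funext => x; case: (f x) (g x) => [u v] [w z].
  by apply: integrableD => //; apply: integrableD => //; exact: integrableZl.
Qed.

Lemma cintegralD c f g : cintegrable f -> cintegrable g ->
  cintegral mu (fun x => c * f x + g x) = c * cintegral mu f + cintegral mu g.
Proof.
case: c => a b [rf jf] [rg jg]; rewrite /cintegral.
have Z (r : R) (u : borel p_pr -> R) : mu.-integrable setT (EFin \o u) ->
    mu.-integrable setT (EFin \o (fun x => r * u x)) by exact: integrableZl.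
apply/eqP; rewrite eq_complex /=; apply/andP; split; apply/eqP.
- transitivity (Rintegral mu setT
    (fun x => a * complex.Re (f x) - b * complex.Im (f x) + complex.Re (g x))).
    by congr Rintegral; apply/funext => x; case: (f x) (g x) => [u v] [w z].
  rewrite RintegralD//; last by apply: (integrableB _ (Z _ _ _) (Z _ _ _)).
  by rewrite (RintegralB _ (Z _ _ _) (Z _ _ _))// !RintegralZl.
- transitivity (Rintegral mu setT
    (fun x => a * complex.Im (f x) + b * complex.Re (f x) + complex.Im (g x))).
    by congr Rintegral; apply/funext => x; case: (f x) (g x) => [u v] [w z].
  rewrite RintegralD//; last by apply: (integrableD _ (Z _ _ _) (Z _ _ _)).
  by rewrite (RintegralD _ (Z _ _ _) (Z _ _ _))// !RintegralZl.
Qed.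

Lemma schwartz_cintegrable f : schwartz f -> cintegrable f.
Proof.
by move: f; apply: schwartz_ind; [exact: cintegrable_coset_fun|exact: cintegrableD].
Qed.

Lemma cintegral0 : cintegral mu (fun=> 0) = 0.
Proof. by rewrite /cintegral /Rintegral integral0. Qed.

Lemma cintegralZ c f : schwartz f -> cintegral mu (fun x => c * f x) = c * cintegral mu f.
Proof.
move=> /schwartz_cintegrable fi; rewrite -[RHS]addr0 -cintegral0 -cintegralD//.
  by congr (cintegral mu _); apply/funext => x; rewrite addr0.
by split; exact: integrable0.
Qed.

Lemma cintegral_translate a f : schwartz f ->
  cintegral mu (fun x => f (x + a)) = cintegral mu f.
Proof.
(* [schwartz f] is carried through the induction because linearity of the integral is applied to
   integrable summands. *)
move=> fs; suff [] : schwartz f /\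
  cintegral mu (fun x => f (x + a)) = cintegral mu f by [].
move: f fs; apply: schwartz_ind => [b n|c f g [fs fE] [gs gE]].
  split; first exact: schwartz_coset_fun.
  transitivity (cintegral mu (coset_fun R (b - a) n)).
    congr (cintegral mu _); apply/funext => x.
    by rewrite /coset_fun opprB addrCA addrC addrAC.
  by rewrite !cintegral_coset_fun.
split; first exact: schwartzD.
rewrite !cintegralD; try exact: schwartz_cintegrable; last first.
- exact/schwartz_cintegrable/schwartz_translate.
- exact/schwartz_cintegrable/schwartz_translate.
by rewrite fE gE.
Qed.

(* Translating by some [x0] in [B_n] with [[x0, k] = p^-1] multiplies the
   integral by [chi (p^-1)], which is not 1. *)
Lemma fourier_eq0 n k f : schwartz f -> loc_const n f -> ~~ inB (- n) k ->
  fourier mu f k = 0.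
Proof.
move=> fs fn /inB_dual[x0 x0n x0k]; apply/eqP.
have gs := schwartz_chi k fs.
have : fourier mu f k = chi R (p%:R^-1 : padic p_pr) * fourier mu f k.
  rewrite -cintegralZ// -[LHS](cintegral_translate x0)//.
  congr (cintegral mu _); apply/funext => x.
  by rewrite bracketDl chiD x0k fn// mulrA [X in X * _]mulrC.
move/eqP; rewrite -subr_eq0 -{1}[fourier mu f k]mul1r -mulrBl mulf_eq0.
by rewrite subr_eq0 eq_sym (negbTE (chi_pV R p_pr)).
Qed.

Lemma fourierD c f g k : schwartz f -> schwartz g ->
  fourier mu (fun x => c * f x + g x) k = c * fourier mu f k + fourier mu g k.
Proof.
move=> fs gs; rewrite -cintegralD; last 2 first.
- exact/schwartz_cintegrable/schwartz_chi.
- exact/schwartz_cintegrable/schwartz_chi.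
by congr (cintegral mu _); apply/funext => x; rewrite mulrDr mulrCA.
Qed.

(** The transform exchanges the two scales: constancy modulo [B_N] gives support in [B_(-N)], and
    support in [B_(-N)] gives constancy modulo [B_N]. *)
Lemma schwartz_fourier f : schwartz f -> schwartz (fourier mu f).
Proof.
move=> fs; have [N [fl /supported0 f0]] := fs; exists N; split; last first.
  by move=> k; rewrite subr0 => kN; exact: (fourier_eq0 fs fl).
move=> k h hN; congr (cintegral mu _); apply/funext => x.
have [xN|/f0 ->] := boolP (inB (- N%:Z) x); last by rewrite !mulr0.
by rewrite bracketDr chiD (@chi_bracket_eq1 _ _ _ (- N%:Z) x h) ?opprK// mulr1.
Qed.

(** For k in [B_(-n)] the character is 1 on [B_n] and the integral is a volume; for other k it
    vanishes by [fourier_eq0]. *)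
Lemma fourier_ball n k :
  fourier mu (coset_fun R 0 n) k = (vol R p n)%:C%C * coset_fun R 0 (- n) k.
Proof.
have [kn|kn] := boolP (inB (- n) k); last first.
  rewrite (fourier_eq0 (schwartz_coset_fun R 0 n) (@loc_const_coset_fun R _ _ 0 n) kn).
  by rewrite /coset_fun subr0 (negbTE kn) mulr0.
rewrite {2}/coset_fun subr0 kn mulr1 -(cintegral_coset_fun 0).
congr (cintegral mu _); apply/funext => x; rewrite /coset_fun subr0.
case: (boolP (inB n x)) => [xn|]; last by rewrite mulr0.
by rewrite (chi_bracket_eq1 R xn kn) mul1r.
Qed.

(** Translation by a becomes multiplication by a phase. *)
Lemma fourier_coset_fun a n k : fourier mu (coset_fun R a n) k =
  chi R (bracket a k) * ((vol R p n)%:C%C * coset_fun R 0 (- n) k).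
Proof.
rewrite -fourier_ball -cintegralZ; last exact/schwartz_chi/schwartz_coset_fun.
rewrite -[LHS](cintegral_translate a); last exact/schwartz_chi/schwartz_coset_fun.
congr (cintegral mu _); apply/funext => x.
by rewrite bracketDl chiD (mulrC (chi R (bracket x k))) -mulrA /coset_fun addrK subr0.
Qed.

Lemma volVN n : vol R p n * vol R p (- n) = 1.
Proof.
by rewrite -expfzDr ?pnatr_eq0 -?lt0n ?prime_gt0// mulrN opprK addNr expr0z.
Qed.

(** On the indicator of [a + B_n] the phase shifts the frequency from k to [k + a]; the two volumes
    cancel and the indicator of [B_n] at [k + a] remains. The sign in [- k] comes from using the
    kernel [chi] twice, without conjugation. *)
Lemma fourier_inversion f k : schwartz f ->
  cintegral mu (fun x => chi R (bracket x k) * fourier mu f x) = f (- k).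
Proof.
move=> fs; suff [] : schwartz f /\
  cintegral mu (fun x => chi R (bracket x k) * fourier mu f x) = f (- k) by [].
move: f fs; apply: schwartz_ind => [a n|c f g [fs fE] [gs gE]].
  split; first exact: schwartz_coset_fun.
  transitivity ((vol R p n)%:C%C * fourier mu (coset_fun R 0 (- n)) (k + a)).
    rewrite -cintegralZ; last exact/schwartz_chi/schwartz_coset_fun.
    congr (cintegral mu _); apply/funext => x; rewrite fourier_coset_fun.
    have E (K : comNzRingType) (s t u v : K) : s * (t * (u * v)) = u * (s * t * v).
      by ring.
    by rewrite bracketDr chiD (bracketC a) E.
  rewrite fourier_ball mulrA -rmorphM volVN rmorph1 mul1r opprK.
  by rewrite /coset_fun subr0 -inBN opprD.
split; first exact: schwartzD.
under eq_fun do rewrite fourierD//.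
rewrite -fE -gE -cintegralD; last 2 first.
- exact/schwartz_cintegrable/schwartz_chi/schwartz_fourier.
- exact/schwartz_cintegrable/schwartz_chi/schwartz_fourier.
by congr (cintegral mu _); apply/funext => x; rewrite mulrDr mulrCA.
Qed.

Lemma schwartz_inv_fourier f : schwartz f -> schwartz (inv_fourier mu f).
Proof.
move=> /schwartz_fourier[N [fl /supported0 f0]].
have -> : inv_fourier mu f = fourier mu f \o -%R.
  apply/funext => k; congr (cintegral mu _); apply/funext => x.
  by rewrite bracketNr bracketC.
exists N; split=> [x h hN|x] /=; first by rewrite opprD fl// inBN.
by rewrite subr0 -inBN => /f0.
Qed.

End Integral.

(** * The symbol near the mass shell, and its product with the transformed plane wave *)

Section Symbol.
Variables (R : realType) (p : nat) (p_pr : prime p).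
Variable mu : {measure set (borel p_pr) -> \bar R}.
Hypothesis mu_haar : normalized_haar mu.
Variables (alpha : R) (m : padic p_pr).
Hypothesis alpha_gt0 : 0 < alpha.
Local Notation Qp4 := (Qp4 p_pr).
Local Notation Cplx := (Cplx R).
Implicit Types (x y h k a : Qp4) (f : Qp4 -> Cplx).

Definition rsymbol y : R := (ratr (pnorm (bracket y y - m ^+ 2)) : R) `^ alpha.

Lemma rsymbol_ge0 y : 0 <= rsymbol y.
Proof. exact: powR_ge0. Qed.

(** [Q(y + h) - Q(y) = [y, h] + [h, y + h]], and both y and [y + h] lie in [B_(-M)]. *)
Lemma pnorm_quadformB M (j : nat) y h : inB (- M%:Z) y -> inB j h ->
  pnorm (bracket (y + h) (y + h) - bracket y y) <= p%:R ^+ M * (p%:R^-1) ^+ j.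
Proof.
move=> yM hj.
have -> : p%:R ^+ M * (p%:R^-1) ^+ j = p%:R ^ (- (- M%:Z + j%:Z)) :> rat.
  by rewrite opprD opprK expfzDr ?gt_eqF ?pR_gt0// -exprnP exprVn exprnN.
have E (V : zmodType) (s t u : V) : s + t + u - s = t + u.
  by rewrite -(addrA s) [LHS]addrC addKr.
rewrite bracketDl bracketDr E; apply: pnormD_le; first exact: pnorm_bracket_le.
rewrite [bracket h _]bracketC; apply: pnorm_bracket_le => //.
by apply: inBD => //; apply: inBW hj; lia.
Qed.

(** The isosceles principle of ultrametric spaces. *)
Lemma pnorm_ultra (s t : padic p_pr) : pnorm (t - s) < pnorm s -> pnorm t = pnorm s.
Proof.
move=> ts; apply/le_anti/andP; split.
  by rewrite -(subrK s t); apply: pnormD_le; [exact: ltW|].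
rewrite leNgt; apply/negP => h.
have : pnorm s < pnorm s.
  rewrite -{1}(subKr t s); apply: le_lt_trans (pnormD _ _) _.
  by rewrite gt_max h pnormN ts.
by rewrite ltxx.
Qed.

(** The source of measurability. On the quadric [Q(y) = m ^ 2] the symbol takes its minimum 0, so r
    is negative and every point qualifies; off it the symbol is locally constant. *)
Lemma open_rsymbol_gt (r : R) : open [set y | r < rsymbol y].
Proof.
rewrite openE => y /= ry.
have [y0|y0] := eqVneq (bracket y y - m ^+ 2) 0.
  apply/nbhs_inBP; exists 0%N => h _ /=.
  apply: lt_le_trans (rsymbol_ge0 _).
  by move: ry; rewrite /rsymbol y0 pnorm0 rmorph0 powR0// gt_eqF.
have [M yM] := inB_exists y.
(* On [y + B_n] the quadratic form varies by less than the norm of [Q(y) - m ^ 2], as [pnorm_ultra]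
   requires. *)
have [n nM] : exists n : nat, p%:R ^+ M * (p%:R^-1) ^+ n < pnorm (bracket y y - m ^+ 2).
  have [|n nlt] := @exists_pXN_lt p p_pr (pnorm (bracket y y - m ^+ 2) / p%:R ^+ M).
    by rewrite divr_gt0 ?exprn_gt0 ?pR_gt0// pnorm_gt0.
  by exists n; rewrite mulrC -ltr_pdivlMr ?exprn_gt0 ?pR_gt0// exprVn exprnN.
apply/nbhs_inBP; exists n => h hn /=; rewrite /rsymbol.
rewrite (@pnorm_ultra (bracket y y - m ^+ 2))//.
have E (V : zmodType) (s t u : V) : s - u - (t - u) = s - t.
  by rewrite opprB addrA subrK.
rewrite E; apply: le_lt_trans nM; exact: pnorm_quadformB.
Qed.

Lemma measurable_rsymbol : measurable_fun setT (rsymbol : borel p_pr -> R).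
Proof.
apply: (measurability _ (RGenOInfty.measurableE R)) => _ [_ [r ->] <-].
by rewrite setTI preimage_itvoy; apply: open_borel; exact: open_rsymbol_gt.
Qed.

(** As [Q(a) = m ^ 2], the norm is that of [Q(y) - Q(a)], at most [p ^ (M - j)]; its power alpha is
    geometric in j with ratio [p ^ (- alpha)]. *)
Lemma rsymbol_le M (j : nat) y a : inB (- M%:Z) a -> quadform a = m ^+ 2 ->
  inB j (y - a) ->
  rsymbol y <= (p%:R ^+ M) `^ alpha * (p%:R^-1 `^ alpha) ^+ j.
Proof.
move=> aM am yj.
have p0 : (0 : R) <= p%:R^-1 by rewrite invr_ge0 ler0n.
rewrite -(powR_mulrn j (powR_ge0 _ _)) -powRrM [alpha * _]mulrC powRrM (powR_mulrn j p0).
rewrite -powRM ?exprn_ge0 ?ler0n//.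
have -> : p%:R ^+ M * p%:R^-1 ^+ j = ratr (p%:R ^+ M * (p%:R^-1) ^+ j) :> R.
  by rewrite rmorphM !rmorphXn/= fmorphV/= !ratr_nat.
have ratr_ge0 (q : rat) : 0 <= q -> 0 <= ratr q :> R by rewrite ler0q.
apply: ge0_ler_powR; first exact: ltW.
- by rewrite nnegrE ratr_ge0 ?pnorm_ge0.
- by rewrite nnegrE ratr_ge0// mulr_ge0 ?exprn_ge0 ?invr_ge0 ?ler0n.
by rewrite ler_rat -am -{1 2}(subrKC a y); exact: pnorm_quadformB.
Qed.

Lemma delta_seqE (j : nat) x : delta_seq R j x = p%:R ^+ (4 * j) * coset_fun R 0 j x.
Proof.
rewrite /delta_seq /Omega /coset_fun subr0 indicE; congr (_ * _%:R).
have pj : (0 : rat) < p%:R ^+ j by rewrite exprn_gt0 ?pR_gt0.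
rewrite mem_setE in_itv/= /inB -invr_expz -exprnP -div1r ler_pdivlMr//.
rewrite [vnorm x * _]mulrC mulr_ge0 ?(ltW pj)//.
by rewrite /vnorm le_max pnorm_ge0.
Qed.

(** [delta_seq R j] is constant on cosets of [B_j], so when x moves within one, T is applied to the
    same function. *)
Lemma loc_const_convolution (T : (Qp4 -> Cplx) -> Cplx) (j : nat) :
  loc_const j (convolution T (delta_seq R j)).
Proof.
move=> x h hj; apply: (congr1 T); apply/funext => y.
by rewrite !delta_seqE addrAC (loc_const_coset_fun R 0 _ hj).
Qed.

(** The average of the symbol over [a + B_j], since [p ^ (4 * j)] is the inverse of the volume of
    that ball. *)
Definition smoothed_symbol (j : nat) a : R := Rintegral mu setT
  (fun y => rsymbol y * (p%:R ^+ (4 * j) * \1_(coset a j) y)).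

(** As [B_j] is symmetric, [delta_seq] at [a - y] is a multiple of the indicator of [a + B_j] at y;
    both factors are real. *)
Lemma convolution_symbol (j : nat) a :
  convolution (distribution_of mu (symbol alpha m)) (delta_seq R j) a =
  (smoothed_symbol j a)%:C%C.
Proof.
have E y : symbol alpha m y * delta_seq R j (a - y) =
    (rsymbol y * (p%:R ^+ (4 * j) * \1_(coset a j) y))%:C%C.
  rewrite delta_seqE -(Re_coset_fun R a j y) /symbol -/(rsymbol y).
  rewrite !rmorphM/= rmorphXn rmorph_nat /coset_fun subr0 -inBN opprB.
  by case: inB.
rewrite /convolution /distribution_of /cintegral.
under eq_fun do rewrite E/=.
under [X in (_ +i* Rintegral _ _ X)%C]eq_fun do rewrite E/=.
by rewrite /Rintegral integral0.
Qed.

Lemma smoothed_symbol_ge0 (j : nat) a : 0 <= smoothed_symbol j a.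
Proof.
apply: Rintegral_ge0 => y _.
by rewrite mulr_ge0 ?rsymbol_ge0 ?mulr_ge0 ?exprn_ge0 ?ler0n.
Qed.

Lemma smoothed_symbol_le M (j : nat) a : inB (- M%:Z) a -> quadform a = m ^+ 2 ->
  smoothed_symbol j a <= (p%:R ^+ M) `^ alpha * (p%:R^-1 `^ alpha) ^+ j.
Proof.
move=> aM am; set s := _ * _.
have s0 : 0 <= s by rewrite mulr_ge0 ?exprn_ge0 ?powR_ge0.
pose F y := rsymbol y * (p%:R ^+ (4 * j) * \1_(coset a j) y).
pose G (y : borel p_pr) : R := s * p%:R ^+ (4 * j) * \1_(coset a j) y.
have GI : mu.-integrable setT (EFin \o G).
  exact: (integrableZl measurableT _ (integrable_coset mu_haar a j)).
have F0 y : 0 <= F y.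
  by rewrite mulr_ge0 ?rsymbol_ge0 ?mulr_ge0 ?exprn_ge0 ?ler0n.
have FG y : F y <= G y.
  rewrite /F /G -mulrA indicE; have [/set_mem ya|_] := boolP (y \in coset a j).
    rewrite ler_wpM2r ?mulr1 ?exprn_ge0 ?ler0n//.
    exact: (rsymbol_le aM am ya).
  by rewrite !mulr0.
(* Measurability of the symbol enters here, together with the majorant G. *)
have FI : mu.-integrable setT (EFin \o F).
  apply: le_integrable GI => //.
    apply/measurable_EFinP; apply: measurable_funM; first exact: measurable_rsymbol.
    apply: measurable_funM; first exact: measurable_cst.
    by apply: measurable_indic; exact: measurable_coset.
  move=> y _ /=; rewrite lee_fin !ger0_norm//.
  exact: le_trans (F0 y) (FG y).
apply: le_trans (le_Rintegral _ FI GI _) _ => //.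
rewrite RintegralZl//; last exact: (integrable_coset mu_haar).
rewrite (Rintegral_coset mu_haar) -mulrA /vol exprnP -PoszM.
by rewrite -expfzDr ?pnatr_eq0 -?lt0n ?prime_gt0// subrr expr0z mulr1.
Qed.

Lemma powR_pV_lt1 : p%:R^-1 `^ alpha < 1 :> R.
Proof.
have := @gt0_ltr_powR R alpha alpha_gt0 p%:R^-1 1; rewrite powR1; apply.
- by rewrite nnegrE invr_ge0 ler0n.
- by rewrite nnegrE ler01.
- by rewrite invf_lt1 ?ltr1n ?ltr0n ?prime_gt0 ?prime_gt1.
Qed.

Lemma smoothed_symbol_cvg0 a : quadform a = m ^+ 2 ->
  smoothed_symbol j a @[j --> \oo] --> 0.
Proof.
move=> am; have [M aM] := inB_exists a.
apply: (@squeeze_cvgr _ _ _ _ (fun=> 0)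
  (geometric ((p%:R ^+ M) `^ alpha) (p%:R^-1 `^ alpha))).
- near=> j; rewrite smoothed_symbol_ge0/=; exact: smoothed_symbol_le.
- exact: cvg_cst.
- by apply: cvg_geometric; rewrite ger0_norm ?powR_ge0// powR_pV_lt1.
Unshelve. all: by end_near. Qed.

Lemma dfourier_plane_wave k f : schwartz f ->
  dfourier mu (distribution_of mu (fun x => chi R (bracket x k))) f = f (- k).
Proof. exact: fourier_inversion. Qed.

(** By inversion the transformed plane wave evaluates at [- k], so the sequence is the average
    around [- k] times [f (- k)]. *)
Lemma product_symbol_plane_wave k f : quadform k = m ^+ 2 -> schwartz f ->
  product_seq (distribution_of mu (symbol alpha m))
    (dfourier mu (distribution_of mu (fun x => chi R (bracket x k)))) f j
    @[j --> \oo] --> (0 : Cplx).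
Proof.
move=> km fs; have km' : quadform (- k) = m ^+ 2.
  by rewrite /quadform bracketNl bracketNr opprK.
have E j : product_seq (distribution_of mu (symbol alpha m))
    (dfourier mu (distribution_of mu (fun x => chi R (bracket x k)))) f j =
    (smoothed_symbol j (- k))%:C%C * f (- k).
  rewrite /product_seq dfourier_plane_wave ?convolution_symbol//.
  (* Inversion applies to the product because smoothing has made its first factor locally
     constant. *)
  by apply: (@schwartzMl _ _ _ j) fs; exact: loc_const_convolution.
under eq_fun do rewrite E.
(* A positive complex [e] is real, and the modulus of the term is [smoothed_symbol j (- k)] times
   that of [w], so convergence in R suffices. *)
set w := f (- k); apply/cvgrPdist_lt => e; rewrite ltcE/= => /andP[/eqP e_im e0].
have w0 : 0 <= Num.sqrt (complex.Re w ^+ 2 + complex.Im w ^+ 2) by exact: sqrtr_ge0.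
set v := Num.sqrt _ in w0.
have : smoothed_symbol j (- k) * v @[j --> \oo] --> 0 * v.
  by apply: cvgMl; exact: smoothed_symbol_cvg0.
rewrite mul0r => /cvgrPdist_lt/(_ _ e0); apply: filterS => j.
rewrite !sub0r !normrN ger0_norm ?mulr_ge0 ?smoothed_symbol_ge0// => h.
rewrite normrM !normc_def -/v /= expr0n/= addr0 sqrtr_sqr.
rewrite ger0_norm ?smoothed_symbol_ge0//.
by rewrite -rmorphM ltcE/= e_im eqxx.
Qed.

(** The limit in [product_symbol_plane_wave] serves twice: its existence puts the plane wave in the
    domain, and its value on inverse transforms of test functions gives the equation. *)
Lemma weak_solution_plane_wave k : quadform k = m ^+ 2 ->
  weak_solution mu alpha m (distribution_of mu (fun x => chi R (bracket x k)))
    (distribution_of mu (fun=> 0)).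
Proof.
move=> km; split; last first.
  move=> f /test_function_schwartz/(schwartz_inv_fourier mu_haar) fs.
  transitivity (0 : Cplx).
    by apply: cvg_lim; [exact: norm_hausdorff|exact: product_symbol_plane_wave].
  rewrite /distribution_of; under eq_fun do rewrite mul0r.
  by rewrite cintegral0.
split=> [c f g /test_function_schwartz fs /test_function_schwartz gs|
         f /test_function_schwartz fs].
  rewrite /distribution_of -cintegralD; last 2 first.
  - by apply: (schwartz_cintegrable mu_haar); exact: schwartz_chi.
  - by apply: (schwartz_cintegrable mu_haar); exact: schwartz_chi.
  by congr (cintegral mu _); apply/funext => x; rewrite mulrDr mulrCA.
by apply/cvg_ex; exists 0; exact: product_symbol_plane_wave.
Qed.

End Symbol.

Theorem lemma9 (R : realType) (p : nat) (p_pr : prime p) (p_neq2 : p <> 2%N)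
  (mu : {measure set (borel p_pr) -> \bar R}) (mu_haar : normalized_haar mu)
  (alpha : R) (alpha_gt0 : 0 < alpha)
  (m : padic p_pr) (m_neq0 : m <> 0)
  (E : padic p_pr) (pp : 'rV[padic p_pr]_3)
  (Ep_shell : mass_shell false m (E, pp) \/ mass_shell true m (E, pp)) :
  weak_solution mu alpha m (distribution_of mu (fun tx => chi R (bracket tx (E, pp))))
    (distribution_of mu (fun=> 0)).
Proof.
by apply: weak_solution_plane_wave => //; case: Ep_shell => -[].
Qed.
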